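(* Let $M\cong\mathbb{Z}^n$ with basis $e_1,\dots,e_n$ and corresponding coordinates $y_1,\dots,y_n$ on $M_{\mathbb{R}}=M\otimes_{\mathbb{Z}}\mathbb{R}$. Let $Z$ be a positive definite symmetric bilinear form on $M_{\mathbb{R}}$ with $Z(M,M)\subset\mathbb{Z}$, $Z_{ij}=Z(e_i,e_j)$, $\overline{\varphi}(y)=\frac12Z(y,y)$. Let $\varphi:M_{\mathbb{R}}\to\mathbb{R}$ be the convex piecewise linear function whose graph is the lower boundary of the convex hull of $\{(m,\overline{\varphi}(m)) \mid m\in M\}\subset M_{\mathbb{R}}\times\mathbb{R}$, and assume that the slope $d\varphi|_\sigma$ lies in $N=\mathrm{Hom}_{\mathbb{Z}}(M,\mathbb{Z})$ for every maximal domain of linearity $\sigma$ of $\varphi$. For an integer $k\gg1$ let $B_k=M_{\mathbb{R}}/kM$, $B_k(\mathbb{Z})=M/kM\subset B_k$, and $B=M_{\mathbb{R}}/M$. (1) For any $k\gg1$, the Monge–Ampère measure of $\varphi$ on $B_k$ is $$\mathrm{MA}(\varphi)=\det(Z_{ij})\sum_{m\in B_k(\mathbb{Z})}\delta_m,$$ where $\delta_m$ is the Dirac measure at $m$. (2) Let $\chi_k:B\to B_k$ be induced by the dilation $y_i\mapsto ky_i$, $i=1,\dots,n$, of $M_{\mathbb{R}}$. Then $\frac1{k^2}\chi_k^*\varphi-\overline{\varphi}$ is a well-defined function on $B$, and $$\sup_B\Big|\frac1{k^2}\chi_k^*\varphi-\overline{\varphi}\Big|\to0\quad\text{as }k\to\infty.$$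 (3) As $k\to\infty$, $$\frac1{k^n}\chi_k^*\mathrm{MA}(\varphi)\rightharpoonup\mathrm{MA}(\overline{\varphi})=\det(Z_{ij})\,dy_1\wedge\cdots\wedge dy_n$$ weakly, as measures on $B$.
   Context: For $\gamma\in M$ let $\alpha_\gamma(y)=Z(\gamma,y)+\frac12Z(\gamma,\gamma)$, an affine linear function. Then $\overline{\varphi}(y+\gamma)=\overline{\varphi}(y)+\alpha_\gamma(y)$ and $\varphi(y+\gamma)=\varphi(y)+\alpha_\gamma(y)$ for all $\gamma\in M$. So $\varphi$ and $\overline{\varphi}$ are regarded as multivalued functions on $B_k$ and on $B$, any two local sheets of which differ by an affine linear function. **Monge–Ampère measure.** For a convex function $f$ and a point $y_0$, let $$\partial f(y_0)=\{\upsilon\in N_{\mathbb{R}} \mid f(y)\ge\langle\upsilon,y-y_0\rangle+f(y_0)\ \text{for all }y\in M_{\mathbb{R}}\},$$ where $N_{\mathbb{R}}=N\otimes_{\mathbb{Z}}\mathbb{R}$ and $\langle\cdot,\cdot\rangle$ is the natural pairing. For a Borel set $E$, $\mathrm{MA}(f)(E)=\mathrm{Vol}\big(\bigcup_{y\in E}\partial f(y)\big)$, where $\mathrm{Vol}$ is the standard Euclidean (Lebesgue) measure on $N_{\mathbb{R}}\cong\mathbb{R}^n$ with respect to the dual basis $e_1^*,\dots,e_n^*$ of $N$. Since $\mathrm{MA}(f+\alpha)=\mathrm{MA}(f)$ for every affine linear $\alpha$, the measures $\mathrm{MA}(\varphi)$ and $\mathrm{MA}(\overline{\varphi})$ on $M_{\mathbb{R}}$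 are invariant under translation by $M$ and hence define measures on $B_k$ (computed locally on small open sets identified with open subsets of $M_{\mathbb{R}}$) and on $B$. $\frac1{k^2}\chi_k^*\varphi-\overline{\varphi}$ denotes the function induced on $B$ by $y\mapsto\frac1{k^2}\varphi(ky)-\overline{\varphi}(y)$. The pull-back $\chi_k^*\mu$ of a measure $\mu$ on $B_k$ under the diffeomorphism $\chi_k$ is the push-forward of $\mu$ under $\chi_k^{-1}$ (so $\chi_k^*\delta_m=\delta_{\chi_k^{-1}(m)}$). Weak convergence is tested against smooth functions on $B$. *)

(* Defs.v *)
From HB Require Import structures.
From mathcomp Require Import all_boot all_order all_algebra.
From mathcomp Require Import generic_quotient.
From mathcomp Require Import all_classical all_reals all_analysis.
Import Order.TTheory GRing.Theory Num.Theory.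
Import numFieldNormedType.Exports.

Set Implicit Arguments.
Unset Strict Implicit.
Unset Printing Implicit Defensive.

Local Open Scope classical_set_scope.
Local Open Scope ring_scope.

(* M = Z^n sits in M_R = R^n as the integral row vectors.  N_R is identified
   with R^n through the dual basis, so that N is again [lattice]. *)
Definition lattice {R : realType} {n : nat} : set 'rV[R]_n :=
  [set m | forall i, m 0 i \is a Num.int].

Definition pairing {R : realType} {n : nat} (u y : 'rV[R]_n) : R :=
  \sum_(i < n) u 0 i * y 0 i.

Section ConvexFunctions.
Context {R : realType} {n : nat}.
Implicit Types (f : 'rV[R]_n -> R) (u y : 'rV[R]_n) (s : set 'rV[R]_n).

Definition quad (Z : 'rV[R]_n -> 'rV[R]_n -> R) y : R := 2^-1 * Z y y.

Definition convex_hull (V : lmodType R) (A : set V) : set V :=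
  smallest (@convex_set R V) A.

Definition lower_boundary (C : set ('rV[R]_n * R^o)) : set ('rV[R]_n * R^o) :=
  [set p | C p /\ forall t : R^o, C (p.1, t) -> p.2 <= t].

Definition graph f : set ('rV[R]_n * R^o) := [set p | p.2 = f p.1].

Definition affine_on f s u :=
  exists c : R, forall y, s y -> f y = pairing u y + c.

(* Only top-dimensional domains of linearity have a well-defined slope, whence
   the nonempty interior. *)
Definition linearity_domain f s :=
  [/\ @convex_set R 'rV[R]_n s, s° !=set0 & exists u, affine_on f s u].

Definition maximal_linearity_domain f s :=
  linearity_domain f s /\
  forall s', linearity_domain f s' -> s `<=` s' -> s' = s.

Definition subdiff f (y0 : 'rV[R]_n) : set 'rV[R]_n :=
  [set u | forall y, pairing u (y - y0) + f y0 <= f y].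

Definition box (a b : 'rV[R]_n) : set 'rV[R]_n :=
  [set x | forall i, a 0 i < x 0 i <= b 0 i].

Definition box_volume (a b : 'rV[R]_n) : R :=
  \prod_(i < n) Num.max 0 (b 0 i - a 0 i).

(* Lebesgue outer measure.  It is total and agrees with Lebesgue measure on all
   Lebesgue measurable sets: the set of subgradients over a Borel set is
   Lebesgue measurable but need not be Borel.  The covers are indexed by
   arbitrary sets of naturals, so that finite covers are allowed even when
   n = 0, where no box is empty. *)
Definition Vol (A : set 'rV[R]_n) : \bar R :=
  ereal_inf [set v | exists (D : set nat) (a b : nat -> 'rV[R]_n),
    A `<=` \bigcup_(j in D) box (a j) (b j) /\
    v = \esum_(j in D) (box_volume (a j) (b j))%:E].

Definition MA f (E : set 'rV[R]_n) : \bar R := Vol (\bigcup_(y in E) subdiff f y).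

End ConvexFunctions.

Section Torus.
Local Open Scope quotient_scope.
Context (R : realType) (n : nat).

Definition torus_rel (k : nat) (x y : 'rV[R]_n) : bool :=
  `[< exists2 m, lattice m & x - y = k%:R *: m >].

Lemma torus_rel_equiv k : equiv_class_of (torus_rel k).
Proof.
split.
- move=> x; apply/asboolP; exists 0; last by rewrite subrr scaler0.
  by move=> i; rewrite mxE rpred0.
- suff H x y : torus_rel k x y -> torus_rel k y x.
    by move=> x y; apply/idP/idP; apply: H.
  move=> /asboolP[m mM xy]; apply/asboolP; exists (- m).
    by move=> i; rewrite mxE rpredN.
  by rewrite scalerN -xy opprB.
- move=> y x z /asboolP[m mM xy] /asboolP[m' mM' yz]; apply/asboolP.
  exists (m + m'); first by move=> i; rewrite mxE rpredD.
  by rewrite scalerDr -xy -yz addrA subrK.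
Qed.

Canonical torus_equiv (k : nat) := EquivRelPack (torus_rel_equiv k).

(* M_R / kM *)
Definition torus (k : nat) : Type :=
  quotient_topology {eq_quot torus_equiv k}.

HB.instance Definition _ k :=
  PointedTopological.copy (torus k) (quotient_topology {eq_quot torus_equiv k}).
HB.instance Definition _ k :=
  Quotient.copy (torus k) (quotient_topology {eq_quot torus_equiv k}).
HB.instance Definition _ k :=
  Measurable.copy (torus k) (g_sigma_algebraType (@open (torus k))).

Definition torus_pi (k : nat) (y : 'rV[R]_n) : torus k := \pi_(torus k) y.

Lemma torus_piP k x y :
  torus_pi k x = torus_pi k y <-> exists2 m, lattice m & x - y = k%:R *: m.
Proof.
split=> [/eqquotP/asboolP//|xy].
by apply/eqquotP/asboolP.
Qed.

(* B_k(Z) = M / kM *)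
Definition torus_lattice (k : nat) : set (torus k) := torus_pi k @` lattice.

(* A measure on M_R / kM which on every small open set, identified with an
   open subset U of M_R, is given by nu. *)
Definition locally_given (k : nat) (nu : set 'rV[R]_n -> \bar R)
    (mu : {measure set (torus k) -> \bar R}) :=
  forall U : set 'rV[R]_n, open U -> set_inj U (torus_pi k) ->
  forall E : set 'rV[R]_n, <<s open >> E -> E `<=` U ->
    mu (torus_pi k @` E) = nu E.

(* The measure on M_R / kM locally given by nu.  Countably many small open sets
   cover the torus, so there is at most one; the value 0 when there is none is
   a dummy. *)
Definition torus_measure (k : nat) (nu : set 'rV[R]_n -> \bar R) :
    {measure set (torus k) -> \bar R} :=
  if pselect (exists mu, locally_given nu mu) is left ex
  then projT1 (cid ex) else mzero.

Definition MA_torus (k : nat) (f : 'rV[R]_n -> R) := torus_measure k (MA f).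

(* dy_1 /\ ... /\ dy_n on B = M_R / M *)
Definition torus_volume := torus_measure 1 (@Vol R n).

(* chi_k : B -> B_k and its inverse *)
Definition dilation (k : nat) (b : torus 1) : torus k :=
  torus_pi k (k%:R *: repr b).

Definition dilation_inv (k : nat) (b : torus k) : torus 1 :=
  torus_pi 1 (k%:R^-1 *: repr b).

Lemma dilation_pi k y : dilation k (torus_pi 1 y) = torus_pi k (k%:R *: y).
Proof.
have /torus_piP[m mM e] : torus_pi 1 (repr (torus_pi 1 y)) = torus_pi 1 y.
  by rewrite /torus_pi reprK.
by apply/torus_piP; exists m => //; rewrite -scalerBr e scale1r.
Qed.

Lemma dilation_inv_pi k y :
  (0 < k)%N -> dilation_inv (torus_pi k y) = torus_pi 1 (k%:R^-1 *: y).
Proof.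
move=> k0.
have /torus_piP[m mM e] : torus_pi k (repr (torus_pi k y)) = torus_pi k y.
  by rewrite /torus_pi reprK.
apply/torus_piP; exists m => //.
by rewrite -scalerBr e scalerA mulVf ?pnatr_eq0 -?lt0n.
Qed.

Lemma dilationK k : (0 < k)%N -> cancel (@dilation k) (@dilation_inv k).
Proof.
move=> k0 b; rewrite -[b in LHS]reprK -/(torus_pi 1 _) dilation_pi.
rewrite dilation_inv_pi// scalerA mulVf ?pnatr_eq0 -?lt0n// scale1r.
exact: reprK.
Qed.

Lemma dilation_invK k : (0 < k)%N -> cancel (@dilation_inv k) (@dilation k).
Proof.
move=> k0 b; rewrite -[b in LHS]reprK -/(torus_pi k _) dilation_inv_pi//.
rewrite dilation_pi scalerA mulfV ?pnatr_eq0 -?lt0n// scale1r.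
exact: reprK.
Qed.

Lemma continuous_dilation_inv k : continuous (@dilation_inv k).
Proof.
case: k => [|k].
  suff -> : @dilation_inv 0 = cst (torus_pi 1 0) by exact: cst_continuous.
  by apply/funext => b; rewrite /dilation_inv invr0 scale0r.
apply/quotient_continuous.
rewrite (_ : _ \o _ = torus_pi 1 \o ( *:%R k.+1%:R^-1)).
  move=> x; apply: continuous_comp; last exact: pi_continuous.
  exact: scaler_continuous.
by apply/funext => y; exact: dilation_inv_pi.
Qed.

Lemma measurable_dilation_inv k : measurable_fun setT (@dilation_inv k).
Proof.
apply: (measurability (@open (torus 1))) => // _ [A oA <-].
rewrite setTI; apply: sub_sigma_algebra.
by move/continuousP: (@continuous_dilation_inv k); apply.
Qed.

(* chi_k^* mu, the push-forward of mu under the inverse of chi_k *)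
Definition dilation_pullback (k : nat) (mu : {measure set (torus k) -> \bar R}) :
  set (torus 1) -> \bar R := pushforward mu (@dilation_inv k).

Section PullbackMeasure.
Local Open Scope ereal_scope.
Variables (k : nat) (mu : {measure set (torus k) -> \bar R}).

Let measurable_pre A : measurable A -> measurable (@dilation_inv k @^-1` A).
Proof.
by move=> mA; rewrite -[X in measurable X]setTI; exact: measurable_dilation_inv.
Qed.

Let pullback0 : dilation_pullback mu set0 = 0.
Proof. by rewrite /dilation_pullback /pushforward preimage_set0 measure0. Qed.

Let pullback_ge0 A : 0 <= dilation_pullback mu A.
Proof. exact: (measure_ge0 mu). Qed.

Let pullback_sigma_additive : semi_sigma_additive (dilation_pullback mu).
Proof.
move=> F mF tF mUF; rewrite /dilation_pullback /pushforward preimage_bigcup.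
apply: measure_semi_sigma_additive.
- by move=> i; exact: measurable_pre.
- apply/trivIsetP => /= i j _ _ ij; rewrite -preimage_setI.
  by move/trivIsetP : tF => /(_ _ _ _ _ ij) ->//; rewrite preimage_set0.
- by rewrite -preimage_bigcup; exact: measurable_pre.
Qed.

HB.instance Definition _ := isMeasure.Build _ _ _ (dilation_pullback mu)
  pullback0 pullback_ge0 pullback_sigma_additive.
End PullbackMeasure.

Fixpoint Ck (r : nat) (f : 'rV[R]_n -> R) : Prop :=
  if r is r'.+1 then
    continuous f /\ forall i : 'I_n, (forall x, derivable f x 'e_i) /\
                                     Ck r' (fun x => 'D_'e_i f x)
  else continuous f.

(* Smooth functions on B = M_R / M. *)
Definition smooth (f : torus 1 -> R) := forall r, Ck r (f \o torus_pi 1).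

Definition weak_cvg (mu_ : nat -> {measure set (torus 1) -> \bar R})
    (mu : {measure set (torus 1) -> \bar R}) :=
  forall f : torus 1 -> R, smooth f ->
    (\int[mu_ k]_b (f b)%:E)%E @[k --> \oo] --> (\int[mu]_b (f b)%:E)%E.

End Torus.

Arguments torus_lattice {R n}.
Arguments torus_volume {R n}.

(* Main.v *)
(* The lower hull of the points (m, q m), with q = quad Z, has phi m = q m at
   lattice points, and the subgradients of phi at m form the closed cell
   S_m = {u | u.(m' - m) <= q m' - q m for all m' in M}, the image under Z of the
   Voronoi cell of m.  A subgradient at a point outside M lies in two distinct
   cells, hence in a countable union of hyperplanes, which is null.  The cell S_0
   is a fundamental domain of the lattice Z(M), as is the image under Z of the
   unit cube, so Vol S_m = det Z and MA(phi) is det Z times the sum of the Dirac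
   measures on M.  That fundamental domains have equal volume also yields
   Vol(L E) = Vol E for unimodular integral L, whence Vol(Z E) = det Z Vol E by
   the Smith normal form; this gives MA(q).  The difference phi - q is M-periodic
   and bounded, which gives the uniform convergence.  For the weak convergence,
   the rescaled Dirac sum is the image of the Lebesgue measure of the unit cube
   under x |-> ceil(k x) / k, and dominated convergence applies. *)

From HB Require Import structures.
Require Import Defs.
From mathcomp Require Import all_boot all_order all_algebra.
From mathcomp Require Import all_classical all_reals all_analysis.
From mathcomp Require Import measurable_realfun.
From mathcomp Require Import ring lra zify.
From mathcomp Require polyrcf.
Import Order.TTheory GRing.Theory Num.Theory.
Import numFieldNormedType.Exports.

Set Implicit Arguments.
Unset Strict Implicit.
Unset Printing Implicit Defensive.

Local Open Scope classical_set_scope.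
Local Open Scope ring_scope.

(** * Lebesgue measure of R^n *)

(** Since [Vol] is an outer measure, upper bounds need only covers and hold for all sets; additivity
    enters only on Borel sets, through [leb]. The two meet in [le_Vol_packing_covering]: a Borel set
    disjoint from its nonzero lattice translates has at most the volume of a Borel set whose
    translates cover it. Applied in both directions, it takes the place of a change of variables:
    for unimodular images of the cube, for the cells, and for comparing a small set of M_R with the
    part of the unit cube above its image in the torus. Integrality of Z matters here because it
    makes [matrix_of_form Z] an integral matrix, to which the Smith normal form applies. On a torus,
    a measure is first written down as an image of a multiple of Lebesgue measure on the unit cube
    and then shown to be locally given by [MA] or [Vol]; uniqueness identifies it with the chosen
    [torus_measure]. Integrals against the rescaled measures thus become integrals over one fixed
    space, whatever k. *)

Section Volume.
Context {R : realType} {n : nat}.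
Implicit Types (A B : set 'rV[R]_n) (a b x y : 'rV[R]_n).

Lemma box_volume_ge0 a b : 0 <= box_volume a b.
Proof. by apply: prodr_ge0 => i _; rewrite le_max lexx. Qed.

(** [pickle] turns any countable index set into a set of naturals, as the definition of [Vol]
    demands; covers indexed by pairs then need no renumbering. *)
Lemma Vol_le_cover (I : countType) (J : set I) (a b : I -> 'rV[R]_n) A :
  A `<=` \bigcup_(j in J) box (a j) (b j) ->
  (Vol A <= \esum_(j in J) (box_volume (a j) (b j))%:E)%E.
Proof.
move=> AJ; pose ext (f : I -> 'rV[R]_n) k := oapp f 0 (unpickle k).
apply: ereal_inf_lbound; exists (pickle @` J), (ext a), (ext b); split.
  by move=> x /AJ[j Jj xj]; exists (pickle j) => //; rewrite /ext pickleK.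
rewrite esum_image; last by move=> i j _ _; exact: (pcan_inj pickleK).
by apply: eq_esum => j _; rewrite /ext pickleK.
Qed.

Lemma Vol_ge0 A : (0 <= Vol A)%E.
Proof.
apply: le_ereal_inf_tmp => _ [D [a [b [_ ->]]]].
by apply: esum_ge0 => j _; rewrite lee_fin box_volume_ge0.
Qed.

Lemma le_Vol A B : A `<=` B -> (Vol A <= Vol B)%E.
Proof.
move=> AB; apply: le_ereal_inf => v [D [a [b [BD ->]]]].
by exists D, a, b; split => //; apply: subset_trans BD.
Qed.

Lemma Vol_box_le a b : (Vol (box a b) <= (box_volume a b)%:E)%E.
Proof.
have /Vol_le_cover : box a b `<=` \bigcup_(j in [set tt]) box a b.
  by move=> x xab; exists tt.
by move=> /le_trans; apply; rewrite esum_set1// lee_fin box_volume_ge0.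
Qed.

Lemma Vol_esum_le (I : countType) (J : set I) (F : I -> set 'rV[R]_n) A :
  A `<=` \bigcup_(j in J) F j -> (Vol A <= \esum_(j in J) Vol (F j))%E.
Proof.
move=> AJ; have [->|] := eqVneq (\esum_(j in J) Vol (F j))%E +oo%E.
  by rewrite leey.
rewrite -ltey => sfin; apply/lee_addgt0Pr => e e0.
pose d (j : I) : R := e / (2 ^ (pickle j).+1)%:R.
have d0 j : 0 < d j by rewrite divr_gt0// ltr0n expn_gt0.
(* A cover that is optimal up to [d j] exists only when the infimum is finite. *)
have Ffin j : J j -> Vol (F j) \is a fin_num.
  move=> Jj; rewrite ge0_fin_numE ?Vol_ge0//; apply: le_lt_trans sfin.
  rewrite -(@esum_set1 R I j (fun k => Vol (F k))) ?Vol_ge0//=.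
  rewrite [leRHS](esumID [set j]); last by move=> ? _; exact: Vol_ge0.
  rewrite (_ : J `&` [set j] = [set j]); last by apply: setIidr => _ ->.
  by rewrite leeDl// esum_ge0// => ? _; exact: Vol_ge0.
have /choice[c cP] (j : I) : exists c : set nat * (nat -> 'rV[R]_n) *
    (nat -> 'rV[R]_n), J j -> F j `<=` \bigcup_(i in c.1.1) box (c.1.2 i) (c.2 i)
    /\ (\esum_(i in c.1.1) (box_volume (c.1.2 i) (c.2 i))%:E <=
        Vol (F j) + (d j)%:E)%E.
  have [Jj|nJ] := pselect (J j); last by exists (set0, fun=> 0, fun=> 0).
  have [_ [D [a [b [FD ->]]]] le] := lb_ereal_inf_adherent (d0 j) (Ffin _ Jj).
  by exists (D, a, b) => _; split => //; exact: ltW.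
have /Vol_le_cover : A `<=` \bigcup_(p in J `*`` (fun j => (c j).1.1))
    box ((c p.1).1.2 p.2) ((c p.1).2 p.2).
  move=> x /AJ[j Jj]; have [Fj _] := cP _ Jj.
  by move=> /Fj[i ci xi]; exists (j, i).
move=> /le_trans; apply.
rewrite -(@esum_esum _ _ _ _ _
  (fun j i => (box_volume ((c j).1.2 i) ((c j).2 i))%:E)); last first.
  by move=> *; rewrite lee_fin box_volume_ge0.
apply: (@le_trans _ _ (\esum_(j in J) (Vol (F j) + (d j)%:E))).
  by apply: le_esum => j /cP[].
rewrite esumD; [|by move=> *; exact: Vol_ge0|]; last first.
  by move=> j _; rewrite lee_fin ltW.
rewrite leeD2l//; apply: (le_trans _ (epsilon_trick0 xpredT (ltW e0))).
rewrite (@nneseries_esumT _ (fun i => (e / (2 ^ i.+1)%:R)%:E)); last first.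
  by move=> i; rewrite lee_fin divr_ge0// ltW.
rewrite -(@esum_image _ _ _ J pickle (fun i => (e / (2 ^ i.+1)%:R)%:E));
  last by move=> i j _ _; exact: (pcan_inj pickleK).
rewrite [leLHS]esum_mkcond; apply: le_esum => i _.
by case: ifP => // _; rewrite lee_fin divr_ge0// ltW.
Qed.

Lemma Vol0 : Vol (set0 : set 'rV[R]_n) = 0%E.
Proof.
apply/eqP; rewrite eq_le Vol_ge0 andbT.
have /Vol_esum_le : (set0 : set 'rV[R]_n) `<=`
  \bigcup_(j in (set0 : set unit)) set0 by [].
by rewrite esum_set0.
Qed.

Lemma Vol_sigma_subadditive : sigma_subadditive (@Vol R n).
Proof.
move=> F; rewrite nneseries_esumT; last by move=> ?; exact: Vol_ge0.
exact: Vol_esum_le.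
Qed.

HB.instance Definition _ := isOuterMeasure.Build R 'rV[R]_n (@Vol R n)
  Vol0 Vol_ge0 le_Vol Vol_sigma_subadditive.


Lemma esumZl (D : set nat) (f : nat -> \bar R) (c : R) : 0 <= c ->
  (forall i, D i -> 0 <= f i)%E ->
  (\esum_(i in D) (c%:E * f i) = c%:E * \esum_(i in D) f i)%E.
Proof.
move=> c0 f0; rewrite esum_mkcond [in RHS]esum_mkcond.
have g0 i : (0 <= if i \in D then f i else 0)%E.
  by case: ifPn => // /set_mem /f0.
rewrite -[in RHS]nneseries_esumT// -nneseriesZl// nneseries_esumT; last first.
  by move=> i; rewrite mule_ge0.
by apply: eq_esum => i _; case: ifP => //; rewrite mule0.
Qed.

(** [T] carries a cover of [A] by boxes to a cover of the image, so a bound on boxes extends to all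
    sets, measurable or not. *)
Lemma Vol_image_le (T : 'rV[R]_n -> 'rV[R]_n) (c : R) A : (0 < c)%R ->
  (forall a b, (Vol (T @` box a b) <= c%:E * (box_volume a b)%:E)%E) ->
  (Vol (T @` A) <= c%:E * Vol A)%E.
Proof.
move=> c0 Tbox; rewrite muleC -lee_pdivrMr//.
apply: le_ereal_inf_tmp => _ [D [a [b [AD ->]]]].
rewrite lee_pdivrMr// muleC.
have /Vol_esum_le : T @` A `<=` \bigcup_(j in D) (T @` box (a j) (b j)).
  by move=> _ [x /AD[j Dj xj] <-]; exists j => //; exists x.
move=> /le_trans; apply; rewrite -(esumZl (ltW c0)); last first.
  by move=> *; rewrite lee_fin box_volume_ge0.
by apply: le_esum => j _; exact: Tbox.
Qed.

(** Points are functions on [nat] of which only the first [m] values count, so that induction on the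
    dimension changes no type. *)
Let ind m (a b x : nat -> R) : R :=
  \prod_(i < m) \1_(`]a i, b i]%classic) (x i).
Let vol m (a b : nat -> R) : R := \prod_(i < m) Num.max 0 (b i - a i).

Let ind_ge0 m (a b x : nat -> R) : 0 <= ind m a b x.
Proof. by apply: prodr_ge0 => i _; rewrite indicE. Qed.

(* Integrate the pointwise inequality one coordinate at a time. *)
Lemma box_ineq m (c : R) (a b : nat -> R) (cs : nat -> R)
    (as_ bs : nat -> nat -> R) : 0 <= c -> (forall j, 0 <= cs j) ->
  (forall x : nat -> R, (c * ind m a b x)%:E <=
     \sum_(j <oo) (cs j * ind m (as_ j) (bs j) x)%:E)%E ->
  ((c * vol m a b)%:E <= \sum_(j <oo) (cs j * vol m (as_ j) (bs j))%:E)%E.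
Proof.
have len (u v : R) :
    (\int[lebesgue_measure]_t (\1_(`]u, v]%classic) t)%:E)%E =
    (Num.max 0 (v - u))%:E.
  rewrite integral_indic// setIT; etransitivity;
    first exact: (lebesgue_measure_itv `]u, v]).
  rewrite /= lte_fin.
  case: ltP => uv; first by rewrite max_r// subr_ge0 ltW.
  by rewrite max_l// subr_le0.
have vol_ge0 k (u v : nat -> R) : 0 <= vol k u v.
  by apply: prodr_ge0 => i _; rewrite le_max lexx.
have intZ (u v d : R) : 0 <= d ->
    (\int[lebesgue_measure]_t (d * \1_(`]u, v]%classic) t)%:E)%E =
    (d * Num.max 0 (v - u))%:E.
  move=> d0; under eq_integral do rewrite EFinM.
  rewrite ge0_integralZl//; first by rewrite len EFinM.
  by apply/measurable_EFinP; exact: measurable_indic.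
elim: m c cs => [|m IH] c cs c0 cs0.
  by move=> /(_ (fun=> 0)); rewrite /vol /ind; under eq_eseriesr do
    rewrite big_ord0; under [in X in _ -> X]eq_eseriesr do rewrite big_ord0;
    rewrite !big_ord0.
move=> le.
(* For a fixed last coordinate [t], its indicators are absorbed into the weights; this is why [c]
   and [cs] are arbitrary in the induction. *)
have step t : ((c * \1_(`]a m, b m]%classic) t * vol m a b)%:E <=
    \sum_(j <oo) (cs j * \1_(`]as_ j m, bs j m]%classic) t *
                  vol m (as_ j) (bs j))%:E)%E.
  apply: IH; first by rewrite mulr_ge0// indicE.
    by move=> j; rewrite mulr_ge0// indicE.
  move=> x; pose x' i := if i == m then t else x i.
  have indE (u v : nat -> R) :
      ind m.+1 u v x' = ind m u v x * \1_(`]u m, v m]%classic) t.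
    rewrite /ind big_ord_recr/= /x' eqxx; congr (_ * _).
    by apply: eq_bigr => i _; rewrite ltn_eqF.
  have := le x'; rewrite indE mulrAC mulrA.
  by under eq_eseriesr do rewrite indE mulrA mulrAC.
have volE (u v : nat -> R) : vol m.+1 u v = vol m u v * Num.max 0 (v m - u m).
  by rewrite /vol big_ord_recr.
rewrite volE mulrA -intZ ?mulr_ge0//.
under eq_eseriesr do rewrite volE mulrA -intZ ?mulr_ge0//.
have mf (u v d : R) : measurable_fun [set: R]
    (fun t => (d * \1_(`]u, v]%classic) t)%:E).
  by apply/measurable_EFinP; apply: measurable_funM => //;
    exact: measurable_indic.
rewrite -integral_nneseries//; [|by move=> j; exact: mf|]; last first.
  by move=> j t _; rewrite lee_fin !mulr_ge0// indicE.
apply: ge0_le_integral => //.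
- by move=> t _; rewrite lee_fin !mulr_ge0// indicE.
- exact: mf.
- apply: ge0_emeasurable_sum => [j t _ _|j _]; last exact: mf.
  by rewrite lee_fin !mulr_ge0// indicE.
- by move=> t _; under eq_eseriesr do rewrite mulrAC; rewrite mulrAC.
Qed.

(** A cover of the box says that its indicator is at most the sum of the indicators of the covering
    boxes; [box_ineq] integrates this, with weights that vanish outside [D]. *)
Lemma Vol_box a b : Vol (box a b) = (box_volume a b)%:E.
Proof.
apply/eqP; rewrite eq_le Vol_box_le/=.
apply: le_ereal_inf_tmp => _ [D [as_ [bs [sub ->]]]].
pose nf (u : 'rV[R]_n) (i : nat) : R := oapp (u 0) 0 (insub i).
have nfE u (i : 'I_n) : nf u i = u 0 i by rewrite /nf valK.
have volE u v : box_volume u v = vol n (nf u) (nf v).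
  by apply: eq_bigr => i _; rewrite !nfE.
have indE u v (x : nat -> R) : ind n (nf u) (nf v) x =
    \1_(box u v) (\row_i x i).
  rewrite /ind indicE; have [xb|xb] := boolP (_ \in _).
    apply: big1 => i _; rewrite indicE mem_set//= in_itv/= !nfE.
    by move/set_mem : xb => /(_ i); rewrite mxE.
  apply/eqP/prodf_eq0; apply: contrapT => h; move/negP: xb; apply.
  apply/mem_set => i; rewrite mxE; apply/negPn/negP => xi.
  apply: h; exists i => //; rewrite indicE memNset//= in_itv/= !nfE.
  exact/negP.
rewrite esum_mkcond -nneseries_esumT; last first.
  by move=> j; case: ifP => // _; rewrite lee_fin box_volume_ge0.
have := @box_ineq n 1 (nf a) (nf b) (fun j => (j \in D)%:R)
  (fun j => nf (as_ j)) (fun j => nf (bs j)).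
rewrite mul1r -volE => /(_ ler01) h.
rewrite [leRHS](_ : _ =
    \sum_(j <oo) ((j \in D)%:R * vol n (nf (as_ j)) (nf (bs j)))%:E)%E; last first.
  apply: eq_eseriesr => j _.
  by rewrite volE; case: ifP; rewrite ?mul1r ?mul0r.
apply: h => // x; rewrite mul1r indE indicE.
have [/set_mem xb|] := boolP (_ \in _); last first.
  by move=> _; apply: nneseries_ge0 => j _ _; rewrite lee_fin mulr_ge0.
have [j Dj xj] := sub _ xb.
apply: (le_trans _ (nneseries_lim_ge j.+1 _)); last first.
  by move=> k _ _; rewrite lee_fin mulr_ge0.
rewrite big_nat_recr//= indE indicE !mem_set// mulr1 leeDr//.
by apply: sume_ge0 => i _; rewrite lee_fin mulr_ge0.
Qed.

End Volume.

(** * Borel sets are Caratheodory measurable *)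

Section Borel.
Context {R : realType} {n : nat}.
Implicit Types (A B : set 'rV[R]_n) (a b x y : 'rV[R]_n).

Let cara := caratheodory_type (@Vol R n).

(** The hyperplane cuts each box of a cover into two boxes of the same total volume, [max 0] taking
    care of an empty piece. *)
Lemma caratheodory_halfspace (i : 'I_n) (t : R) :
  measurable ([set x | x 0 i <= t] : set cara).
Proof.
apply: le_caratheodory_measurable => X; set H := [set x | _].
apply: le_ereal_inf_tmp => _ [D [a [b [XD ->]]]].
pose b' j := \row_k if k == i then Num.min (b j 0 k) t else b j 0 k.
pose a' j := \row_k if k == i then Num.max (a j 0 k) t else a j 0 k.
have le1 : (Vol (X `&` H) <= \esum_(j in D) (box_volume (a j) (b' j))%:E)%E.
  apply: Vol_le_cover => x [/XD[j Dj xj] Hx]; exists j => // k.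
  rewrite mxE; case: eqP => [->|_]; last exact: xj.
  by have /andP[-> xb] := xj i; rewrite le_min xb.
have le2 : (Vol (X `&` ~` H) <= \esum_(j in D) (box_volume (a' j) (b j))%:E)%E.
  apply: Vol_le_cover => x [/XD[j Dj xj] Hx]; exists j => // k.
  rewrite mxE; case: eqP => [->|_]; last exact: xj.
  have /andP[ax ->] := xj i; rewrite gt_max ax/= andbT ltNge.
  exact/negP.
apply: (le_trans (leeD le1 le2)).
rewrite -esumD; last 2 first.
- by move=> *; rewrite lee_fin box_volume_ge0.
- by move=> *; rewrite lee_fin box_volume_ge0.
apply: le_esum => j _; rewrite -EFinD lee_fin.
rewrite /box_volume (bigD1 i)//= [X in _ + X](bigD1 i)//= [leRHS](bigD1 i)//=.
rewrite !mxE eqxx.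
rewrite [X in _ * X + _](_ : _ = \prod_(k < n | k != i)
  Num.max 0 (b j 0 k - a j 0 k)); last first.
  by apply: eq_bigr => k /negPf ki; rewrite mxE ki.
rewrite [X in _ + _ * X](_ : _ = \prod_(k < n | k != i)
  Num.max 0 (b j 0 k - a j 0 k)); last first.
  by apply: eq_bigr => k /negPf ki; rewrite mxE ki.
rewrite -mulrDl; apply: ler_wpM2r.
  by apply: prodr_ge0 => k _; rewrite le_max lexx.
move: (a j 0 i) (b j 0 i) => u v; rewrite /Num.max /Num.min.
by repeat case: ifP => ?; lra.
Qed.

Lemma boxE a b : box a b = \bigcap_(i in [set: 'I_n])
  ([set x | x 0 i <= b 0 i] `\` [set x | x 0 i <= a 0 i]).
Proof.
apply/seteqP; split=> x.
  by move=> xab i _; have /andP[ax xb] := xab i; split => //=; rewrite leNgt ax.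
move=> xab i; have [/= xb /negP] := xab i I.
by rewrite -ltNge => ->.
Qed.

Lemma caratheodory_box a b : measurable (box a b : set cara).
Proof.
rewrite boxE; apply: fin_bigcap_measurable => // i _.
by apply: measurableD; exact: caratheodory_halfspace.
Qed.

Lemma ball_rVP x y (e : R) : 0 < e ->
  ball x e y <-> forall i, `|x 0 i - y 0 i| < e.
Proof.
move=> e0; split=> [xy i|xy]; first exact: (xy.2 0 i).
by split => // i j; rewrite ord1; exact: xy.
Qed.

Lemma open_bigcup_box A : open A ->
  exists (D : set nat) (a b : nat -> 'rV[R]_n),
    A = \bigcup_(j in D) box (a j) (b j).
Proof.
move=> oA; pose I := ('rV[rat]_n * nat)%type.
pose u (p : I) : 'rV[R]_n := \row_i (ratr (p.1 0 i) - p.2.+1%:R^-1).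
pose v (p : I) : 'rV[R]_n := \row_i (ratr (p.1 0 i) + p.2.+1%:R^-1).
pose f (k : nat) : I := odflt (0, 0%N) (unpickle k).
exists [set k | box (u (f k)) (v (f k)) `<=` A], (u \o f), (v \o f).
apply/seteqP; split=> [x Ax|x [k +]]; last by apply.
have /nbhs_ballP[e /= e0 xe] : nbhs x A by exact: open_nbhs_nbhs.
have e20 : 0 < e / 2 by rewrite divr_gt0.
(* A box of half side [1/(k+1)] centred at a rational point within [1/(k+1)] of [x] contains [x] and
   stays within [2/(k+1) < e] of it. *)
have [k] := ltr_add_invr e20; rewrite add0r => ke.
have k0 : 0 < k.+1%:R^-1 :> R by [].
have /choice[q qP] (i : 'I_n) : exists q : rat,
    ratr q \in `](x 0 i - k.+1%:R^-1), (x 0 i + k.+1%:R^-1)[.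
  by apply: rat_in_itvoo; rewrite ltrBlDr -addrA ltrDl addr_gt0.
have fp : f (pickle ((\row_i q i, k) : I)) = (\row_i q i, k).
  by rewrite /f pickleK.
exists (pickle ((\row_i q i, k) : I)).
  move=> y; rewrite /= fp => yb; apply: xe; apply/ball_rVP => // i.
  have := yb i; have := qP i; rewrite !mxE/= in_itv/= ltr_norml.
  by move: (x 0 i) (y 0 i) (ratr _) (_^-1) ke => *; lra.
move=> i; rewrite /= fp !mxE/=.
have := qP i; rewrite in_itv/=.
by move: (x 0 i) (ratr _) (_^-1) => *; lra.
Qed.

Definition borel := g_sigma_algebraType (@open 'rV[R]_n).
HB.instance Definition _ := Measurable.on borel.

Lemma borel_caratheodory (A : set borel) :
  measurable A -> measurable (A : set cara).
Proof.
apply: smallest_sub; last first.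
  move=> /= B /open_bigcup_box[D [a [b ->]]].
  by apply: bigcup_measurable => j _; exact: caratheodory_box.
by split=> [|B mB|F mF]; [exact: measurable0|rewrite setTD; exact: measurableC|
  exact: bigcup_measurable].
Qed.

(** [Vol] on the type carrying the Borel sigma-algebra, where it is a measure; statements go back
    and forth between the two by conversion. *)
Definition leb : set borel -> \bar R := @Vol R n.

Let leb0 : leb set0 = 0%E. Proof. exact: Vol0. Qed.
Let leb_ge0 (A : set borel) : (0 <= leb A)%E. Proof. exact: Vol_ge0. Qed.
Let leb_sigma_additive : semi_sigma_additive leb.
Proof.
move=> F mF tF mUF.
apply: (@caratheodory_measure_sigma_additive _ _ (@Vol R n)) => //.
- by move=> i; exact: borel_caratheodory.
- exact: borel_caratheodory.
Qed.

HB.instance Definition _ := isMeasure.Build _ _ _ leb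
  leb0 leb_ge0 leb_sigma_additive.

Lemma borel_open A : open A -> measurable (A : set borel).
Proof. exact: sub_sigma_algebra. Qed.

Lemma borel_closed A : closed A -> measurable (A : set borel).
Proof.
move=> cA; rewrite -[A]setCK; apply: measurableC; apply: borel_open.
exact: closed_openC.
Qed.

Lemma borel_halfspace (i : 'I_n) (t : R) :
  measurable ([set x | x 0 i <= t] : set borel).
Proof.
apply: borel_closed; apply: (@closed_comp _ _ (fun x : 'rV[R]_n => x 0 i)
  [set s | s <= t]); last exact: closed_le.
by move=> x _; exact: coord_continuous.
Qed.

Lemma borel_box a b : measurable (box a b : set borel).
Proof.
rewrite boxE; apply: fin_bigcap_measurable => // i _.
by apply: measurableD; exact: borel_halfspace.
Qed.

Lemma borel_continuous (f : 'rV[R]_n -> 'rV[R]_n) (A : set borel) :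
  continuous f -> measurable A -> measurable (f @^-1` A : set borel).
Proof.
move=> cf; have mf : measurable_fun [set: borel] (f : borel -> borel).
  apply: (@measurability _ _ borel borel _ f (@open 'rV[R]_n)) => // _ [B oB <-].
  by rewrite setTI; apply: borel_open; move/continuousP: cf; apply.
by move=> mA; rewrite -[X in measurable X]setTI; exact: mf.
Qed.

End Borel.

(** * Lattices and linear changes of variables *)

Section Linear.
Context {R : realType} {n : nat}.
Implicit Types (P Q E : set 'rV[R]_n) (a b x y v : 'rV[R]_n) (A : 'M[R]_n).

Definition zvec (z : 'rV[int]_n) : 'rV[R]_n := map_mx intr z.

Definition lin A E : set 'rV[R]_n := (fun x => x *m A) @` E.

(** The half-open cube [(0,1]^n] is a strict fundamental domain for the integer vectors. *)
Definition cube : set 'rV[R]_n := box 0 (const_mx 1).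

Lemma zvec_inj : injective zvec.
Proof.
by move=> u v /matrixP e; apply/matrixP => i j; have := e i j;
  rewrite !mxE => /intr_inj.
Qed.

Lemma latticeP v : lattice v <-> exists z, v = zvec z.
Proof.
split=> [vL|[z ->] i]; last by rewrite mxE rpred_int_num.
exists (\row_i Num.floor (v 0 i)); apply/rowP => i; rewrite !mxE.
by rewrite (floorK (vL i)).
Qed.

Lemma zvecD z z' : zvec (z + z') = zvec z + zvec z'.
Proof. exact: map_mxD. Qed.

Lemma zvecN z : zvec (- z) = - zvec z.
Proof. exact: map_mxN. Qed.

Lemma zvec0 : zvec 0 = 0.
Proof. exact: map_mx0. Qed.

Lemma zvecM z (L : 'M[int]_n) : zvec z *m map_mx intr L = zvec (z *m L).
Proof. by rewrite /zvec map_mxM. Qed.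

Lemma Vol_shift E v : Vol [set x | E (x - v)] = Vol E.
Proof.
suff le (w : 'rV[R]_n) (F : set 'rV[R]_n) :
    (Vol [set x | F (x - w)%R] <= Vol F)%E.
  apply/eqP; rewrite eq_le le/=.
  rewrite {1}(_ : E = [set x | [set y | E (y - v)] (x - (- v))]); first exact: le.
  by apply/seteqP; split=> x /=; rewrite opprK addrK.
rewrite (_ : [set x | _] = (fun x => x + w) @` F); last first.
  apply/seteqP; split=> [x Fx|_ [x Fx <-]]; last by rewrite /= addrK.
  by exists (x - w) => //; rewrite subrK.
have := @Vol_image_le _ _ (fun x : 'rV[R]_n => x + w) 1 F ltr01.
rewrite mul1e; apply => a b; rewrite mul1e.
have -> : box_volume a b = box_volume (a + w) (b + w).
  by apply: eq_bigr => i _; rewrite !mxE opprD addrACA subrr addr0.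
rewrite -Vol_box; apply: le_Vol => _ [x xab <-] i.
by rewrite !mxE lerD2r ltrD2r; exact: xab.
Qed.

Lemma borel_shift E v : measurable (E : set borel) ->
  measurable ([set x | E (x - v)] : set borel).
Proof.
move=> mE; apply: (@borel_continuous _ _ (fun x => x - v)) => // x.
by apply: (@cvgB _ _ _ (nbhs x) _ id (cst v)); [exact: cvg_id|exact: cvg_cst].
Qed.

Lemma linE A E : A \in unitmx -> lin A E = (fun x => x *m invmx A) @^-1` E.
Proof.
move=> Au; apply/seteqP; split=> [_ [x Ex <-]|x Ex] /=; first by rewrite mulmxK.
by exists (x *m invmx A) => //; rewrite mulmxKV.
Qed.

Lemma mulmxr_continuous A : continuous (fun x : 'rV[R]_n => x *m A).
Proof.
rewrite (_ : (fun x => _) =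
    fun x => \sum_(i < n) x 0 i *: (row i A : 'rV[R]_n)); last first.
  by apply/funext => x; rewrite mulmx_sum_row.
apply: continuous_big; first exact: add_continuous.
move=> i _ x; by apply: (@cvgZr_tmp _ _ _ (nbhs x)); exact: coord_continuous.
Qed.


Lemma lin_comp A B E : lin B (lin A E) = lin (A *m B) E.
Proof.
rewrite /lin image_comp; congr (_ @` _).
by apply/funext => x /=; rewrite mulmxA.
Qed.

Lemma lin1 E : lin 1%:M E = E.
Proof.
rewrite /lin (_ : (fun x => _) = id) ?image_id//.
by apply/funext => x; rewrite mulmx1.
Qed.

Lemma borel_lin A E : A \in unitmx ->
  measurable (E : set borel) -> measurable (lin A E : set borel).
Proof.
move=> Au mE; rewrite linE//; apply: borel_continuous => //.
exact: mulmxr_continuous.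
Qed.

Lemma esum_packing_le (F : 'rV[int]_n -> set 'rV[R]_n) E :
  (forall z, measurable (F z : set borel)) -> trivIset setT F ->
  measurable (E : set borel) -> (forall z, F z `<=` E) ->
  (\esum_(z in setT) Vol (F z) <= Vol E)%E.
Proof.
move=> mF tF mE FE; apply: ge_ereal_sup => _ [X [finX _] <-].
rewrite -(@measure_fin_bigcup _ _ _ leb _ X F)//; last first.
  exact: sub_trivIset tF.
by apply: le_Vol => x [z _ /FE].
Qed.

(** Cut [P] along the translates of [Q] and move each piece back into [Q]. The pieces cover [P], and
    after the move they are disjoint, because [P] meets none of its nonzero translates. Two
    fundamental domains therefore have equal volume. *)
Lemma le_Vol_packing_covering A P Q : A \in unitmx ->
  measurable (P : set borel) -> measurable (Q : set borel) ->
  (forall z x, P x -> P (x + zvec z *m A) -> z = 0) ->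
  (forall x, P x -> exists z, Q (x - zvec z *m A)) ->
  (Vol P <= Vol Q)%E.
Proof.
move=> Au mP mQ packP covQ.
have /Vol_esum_le : P `<=` \bigcup_(z in [set: 'rV[int]_n])
    (P `&` [set x | Q (x - zvec z *m A)]).
  by move=> x Px; have [z Qz] := covQ x Px; exists z.
move=> /le_trans; apply.
rewrite (eq_esum (b := fun z => Vol (Q `&` [set x | P (x - (- (zvec z *m A)))])));
    last first.
  move=> z _; rewrite -(Vol_shift (P `&` _) (- (zvec z *m A))).
  by congr Vol; apply/seteqP; split=> x /=; rewrite opprK addrK => -[].
apply: esum_packing_le => //.
- move=> z; apply: measurableI => //; exact: borel_shift.
- apply/trivIsetP => z z' _ _ zz'; rewrite -subset0 => x [[_ /= +] [_ /=]].
  rewrite !opprK => Pz Pz'; move/eqP: zz'; apply; apply/esym/subr0_eq.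
  apply: (packP _ _ Pz).
  by rewrite zvecD zvecN mulmxBl -addrA [zvec z *m A + _]addrC subrK.
Qed.

Lemma Vol_lin_diag_le (d : 'rV[R]_n) E : (forall i, 0 < d 0 i) ->
  (Vol (lin (diag_mx d) E) <= (\prod_i d 0 i)%:E * Vol E)%E.
Proof.
move=> d0; apply: Vol_image_le; first exact: prodr_gt0.
move=> a b; rewrite -EFinM.
have -> : \prod_i d 0 i * box_volume a b =
    box_volume (a *m diag_mx d) (b *m diag_mx d).
  rewrite -big_split; apply: eq_bigr => i _ /=.
  by rewrite !mul_mx_diag !mxE -mulrBl mulrC maxr_pMl ?mul0r// ltW.
rewrite -Vol_box; apply: le_Vol => _ [x xab <-] i.
by rewrite !mul_mx_diag !mxE ltr_pM2r// ler_pM2r//; exact: xab.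
Qed.

Lemma Vol_lin_diag (d : 'rV[R]_n) E : (forall i, 0 < d 0 i) ->
  Vol (lin (diag_mx d) E) = ((\prod_i d 0 i)%:E * Vol E)%E.
Proof.
move=> d0; apply/eqP; rewrite eq_le Vol_lin_diag_le//=.
have p0 : 0 < \prod_i d 0 i by exact: prodr_gt0.
pose d' : 'rV[R]_n := \row_i (d 0 i)^-1.
rewrite -lee_pdivlMl//.
have -> : (\prod_i d 0 i)^-1 = \prod_i d' 0 i.
  by rewrite -prodfV; apply: eq_bigr => i _; rewrite mxE.
rewrite -[in leLHS](lin1 E) (_ : 1%:M = diag_mx d *m diag_mx d').
  by rewrite -lin_comp; apply: Vol_lin_diag_le => i; rewrite mxE invr_gt0.
apply/matrixP => i j; rewrite mul_diag_mx !mxE.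
by case: eqP => [->|_]; rewrite ?mulr1n ?mulr0n ?mulr0// mulfV// gt_eqF.
Qed.

Lemma Vol_cube : Vol cube = 1%E.
Proof.
rewrite Vol_box /box_volume big1// => i _.
by rewrite !mxE subr0 max_r.
Qed.

Lemma cube_packing z x : cube x -> cube (x + zvec z) -> z = 0.
Proof.
move=> xc xzc; apply/rowP => i; rewrite mxE.
have := xc i; have := xzc i; rewrite !mxE => h1 h2.
have {h1 h2} : -1 < (z 0 i)%:~R :> R /\ (z 0 i)%:~R < 1 :> R by split; lra.
rewrite -[1]/(1%:~R) -mulrNz !ltr_int => -[].
by case: (z 0 i) => [[]|[]].
Qed.

Lemma cube_covering x : exists z, cube (x - zvec z).
Proof.
(* Ceiling minus one, not floor, since [cube] is open at 0 and closed at 1. *)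
exists (\row_i (Num.ceil (x 0 i) - 1)) => i; rewrite !mxE.
have := ceil_itv (x 0 i); rewrite rmorphB/= => /andP[h1 h2]; lra.
Qed.

Lemma lin_cube_packing A z x : A \in unitmx ->
  lin A cube x -> lin A cube (x + zvec z *m A) -> z = 0.
Proof.
move=> Au; rewrite linE//= => xc; rewrite mulmxDl mulmxK//.
exact: cube_packing.
Qed.

Lemma lin_cube_covering A x : A \in unitmx ->
  exists z, lin A cube (x - zvec z *m A).
Proof.
move=> Au; have [z zc] := cube_covering (x *m invmx A).
by exists z; rewrite linE//= mulmxBl mulmxK.
Qed.

Lemma unitmx_intr (L : 'M[int]_n) : L \in unitmx ->
  map_mx intr L \in @unitmx R n.
Proof. by rewrite !unitmxE det_map_mx; exact: rmorph_unit. Qed.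

(** A unimodular [L] permutes the integer vectors, so the image of the cube is again a fundamental
    domain for them. *)
Lemma Vol_lin_int_cube (L : 'M[int]_n) : L \in unitmx ->
  Vol (lin (map_mx intr L) cube) = 1%E.
Proof.
move=> Lu; have Lu' := unitmx_intr Lu.
have mc : measurable (cube : set borel) by exact: borel_box.
have mLc := borel_lin Lu' mc.
apply/eqP; rewrite eq_le -Vol_cube; apply/andP; split.
  apply: (le_Vol_packing_covering (unitmx1 _ _)) => //.
    move=> z x xc; rewrite mulmx1 -[z](mulmxKV Lu) -zvecM => h.
    by rewrite (lin_cube_packing Lu' xc h) mul0mx.
  by move=> x _; have [z zc] := cube_covering x; exists z; rewrite mulmx1.
apply: (le_Vol_packing_covering (unitmx1 _ _)) => //.
  by move=> z x; rewrite mulmx1; exact: cube_packing.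
move=> x _; have [z zc] := lin_cube_covering x Lu'.
by exists (z *m L); rewrite mulmx1 -zvecM.
Qed.

End Linear.

Section LinearInt.
Context {R : realType} {n : nat}.
Implicit Types (P Q E : set 'rV[R]_n) (a b x y v : 'rV[R]_n) (A : 'M[R]_n).

Lemma lin_shift A E v :
  lin A [set x | E (x - v)] = [set x | lin A E (x - v *m A)].
Proof.
apply/seteqP; split=> [_ [x Ex <-]|x [y Ey] /=].
  by exists (x - v) => //=; rewrite mulmxBl.
by move/eqP; rewrite eq_sym subr_eq => /eqP ->; exists (y + v);
  rewrite /= ?addrK// mulmxDl.
Qed.

(* A box is covered by about [\prod_i (b i - a i) q] cubes of side [1/q]. *)
Lemma Vol_lin_box_le A a b : Vol (lin A cube) = 1%E ->
  (Vol (lin A (box a b)) <= (box_volume a b)%:E)%E.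
Proof.
move=> A1; have [ab|] := boolP [forall i, a 0 i < b 0 i]; last first.
  rewrite negb_forall => /existsP[i]; rewrite -leNgt => ba.
  rewrite (_ : box a b = set0) ?/lin ?image_set0 ?Vol0 ?lee_fin ?box_volume_ge0//.
  rewrite -subset0 => x /(_ i) /andP[ax xb].
  by have := lt_le_trans ax (le_trans xb ba); rewrite ltxx.
have {ab} ab i : a 0 i < b 0 i by exact: (forallP ab).
pose s i := b 0 i - a 0 i.
have s0 i : 0 < s i by rewrite subr_gt0.
(* The products tend to the volume of the box as [q] grows. *)
suff le q : (Vol (lin A (box a b)) <= (\prod_i (s i + q.+1%:R^-1))%:E)%E.
  have cv : (\prod_i (s i + q.+1%:R^-1))%:E @[q --> \oo] -->
      (\prod_i (s i + 0))%:E.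
    apply: cvg_EFin; first exact: nearW.
    apply: (@cvg_big _ _ _ _ xpredT (@mul_continuous R)) => i _.
    by apply: cvgD; [exact: cvg_cst|exact: cvg_harmonic].
  rewrite (_ : box_volume a b = \prod_i (s i + 0)); last first.
    by apply: eq_bigr => i _; rewrite addr0 max_r//; exact: ltW (s0 i).
  by apply: (cvge_to_ge cv); exact: nearW.
(* The number of cubes of side [1/(q+1)] along coordinate [i]: at most [(q+1) * s i + 1], whence the
   factor [s i + 1/(q+1)]. *)
pose N i := (Num.truncn (q.+1%:R * s i)).+1.
pose d : 'rV[R]_n := const_mx q.+1%:R^-1.
have d0 i : 0 < d 0 i by rewrite mxE.
pose I := {dffun forall i : 'I_n, 'I_(N i)}.
pose v (f : I) : 'rV[R]_n := \row_i (a 0 i + (f i)%:R / q.+1%:R).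
have /Vol_esum_le : lin A (box a b) `<=` \bigcup_(f in [set: I])
    lin A [set x | lin (diag_mx d) cube (x - v f)].
  move=> _ [x xab <-].
  pose y i := q.+1%:R * (x 0 i - a 0 i).
  pose m i := `|Num.ceil (y i) - 1|%N.
  have y0 i : 0 < y i by rewrite mulr_gt0// subr_gt0; have /andP[] := xab i.
  have mP i : (m i)%:R < y i <= (m i)%:R + 1.
    have c1 : 0 <= Num.ceil (y i) - 1 by rewrite subr_ge0 -gtz0_ge1 ceil_gt0.
    rewrite natr_absz ger0_norm// rmorphB/= subrK.
    by have := ceil_itv (y i); rewrite rmorphB.
  have mN i : (m i < N i)%N.
    rewrite ltnS truncn_ge_nat; last by rewrite mulr_ge0// ltW.
    have /andP[/ltW/le_trans->//] := mP i.
    by rewrite ler_wpM2l// lerD2r; have /andP[] := xab i.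
  exists [ffun i => Ordinal (mN i)] => //; exists x => //=.
  set w := v _; exists (q.+1%:R *: (x - w)) => [i|]; last first.
    by apply/rowP => i; rewrite mul_mx_diag !mxE mulrC mulKf.
  rewrite !mxE ffunE /= mulrBr mulrDr mulrCA mulfV// mulr1.
  by have := mP i; rewrite /y mulrBr; lra.
move=> /le_trans; apply.
rewrite (eq_esum (b := fun=> ((q.+1%:R^-1) ^+ n)%:E)); last first.
  move=> f _; rewrite lin_shift Vol_shift lin_comp.
  (* [diag_mx d] is a scalar matrix, so the image of a small cube is a scaled copy of the image of
     the unit cube, whose volume is known. *)
  rewrite (_ : diag_mx d *m A = A *m diag_mx d); last first.
    by rewrite /d diag_const_mx scalar_mxC.
  rewrite -lin_comp Vol_lin_diag// A1 mule1; congr (_%:E).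
  rewrite -[n in RHS]card_ord -prodr_const.
  by apply: eq_bigr => i _; rewrite mxE.
rewrite esum_fset; [|exact: finite_finset|]; last first.
  by move=> f _; rewrite lee_fin exprn_ge0.
rewrite (fsbigE (index_enum I))//=; last 2 first.
- exact: index_enum_uniq.
- by move=> f _; rewrite mem_index_enum.
rewrite sumEFin lee_fin [leLHS](_ : _ =
  \sum_(f : I) q.+1%:R^-1 ^+ n); last by apply: eq_bigl => f; exact/mem_set.
rewrite sumr_const card_dep_ffun foldrE big_map big_enum/=.
under eq_bigr do rewrite card_ord.
rewrite -[leLHS]mulr_natl natr_prod -[n in _ ^+ n]card_ord -prodr_const.
rewrite -big_split/=.
apply: ler_prod => i _; apply/andP; split; first by rewrite mulr_ge0.
rewrite ler_pdivrMr// mulrDl mulVf// -[leLHS]natr1 lerD2r mulrC.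
by rewrite truncn_le mulr_ge0// ltW.
Qed.

(** [Vol_lin_box_le] bounds the images of boxes, hence of all sets; the reverse inequality is the
    same bound for the inverse, which is again integral. *)
Lemma Vol_lin_unimodular (L : 'M[int]_n) E : L \in unitmx ->
  Vol (lin (map_mx intr L) E) = Vol E.
Proof.
have le (M : 'M[int]_n) (F : set 'rV[R]_n) : M \in unitmx ->
    (Vol (lin (map_mx intr M) F) <= Vol F)%E.
  move=> Mu; have := @Vol_image_le R n (fun x => x *m map_mx intr M) 1 F ltr01.
  rewrite mul1e; apply => a b; rewrite mul1e.
  by apply: Vol_lin_box_le; exact: Vol_lin_int_cube.
move=> Lu; apply/eqP; rewrite eq_le le//=.
rewrite -[in leLHS](lin1 E) (_ : 1%:M = map_mx intr L *m map_mx intr (invmx L)).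
  by rewrite -lin_comp; apply: le; rewrite unitmx_inv.
by rewrite -map_mxM mulmxV// map_mx1.
Qed.

Lemma Vol_lin_int (Z : 'M[int]_n) E : \det Z != 0 ->
  Vol (lin (map_mx intr Z) E) = (`|(\det Z)%:~R : R|%:E * Vol E)%E.
Proof.
move=> detZ; have [L Lu [U Uu [d _ defZ]]] := int_Smith_normal_form Z.
pose D : 'rV[int]_n := \row_i d`_i.
have {}defZ : Z = L *m diag_mx D *m U.
  by rewrite defZ; congr (_ *m _ *m _); apply/matrixP => i j; rewrite !mxE.
have D0 i : D 0 i != 0.
  apply: contraNneq detZ => Di; rewrite defZ !det_mulmx det_diag.
  by rewrite (bigD1 i)//= Di mul0r mulr0 mul0r.
(* The diagonal entries may be negative: their signs go into the unimodular factor, leaving the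
   positive diagonal that [Vol_lin_diag] requires. *)
pose S : 'rV[int]_n := \row_i sgz (D 0 i).
pose T : 'rV[R]_n := \row_i `|(D 0 i)%:~R|.
have Su : diag_mx S \in unitmx.
  rewrite unitmxE det_diag rpred_prod// => i _; rewrite mxE.
  by have := D0 i; case: sgzP.
have T0 i : 0 < T 0 i by rewrite mxE normr_gt0 intr_eq0.
have -> : map_mx intr Z = map_mx intr (L *m diag_mx S) *m diag_mx T *m
    map_mx intr U :> 'M[R]_n.
  rewrite -[diag_mx T](_ : map_mx intr (diag_mx (\row_i `|D 0 i|)) = _).
    rewrite -!map_mxM defZ -[L *m diag_mx S *m _]mulmxA.
    congr (map_mx _ (_ *m _ *m _)).
    by apply/matrixP => i j; rewrite mul_diag_mx !mxE;
      case: eqP => [->|_]; rewrite ?mulr0n ?mulr0// !mulr1n -numEsg//.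
  apply/matrixP => i j; rewrite !mxE.
  by case: eqP => [->|]; rewrite ?mulr0n// !mulr1n intr_norm.
rewrite -!lin_comp Vol_lin_unimodular// Vol_lin_diag// Vol_lin_unimodular; last first.
  by rewrite unitmx_mul Lu.
congr (_%:E * _)%E; rewrite defZ !det_mulmx !rmorphM !normrM.
have norm1 (M : 'M[int]_n) : M \in unitmx -> `|(\det M)%:~R| = 1 :> R.
  rewrite unitmxE => /divrr/(congr1 absz)/eqP.
  by rewrite abszM muln_eq1 -intr_norm -abszE => /andP[/eqP ->].
rewrite (norm1 _ Lu) (norm1 _ Uu) mul1r mulr1 det_diag rmorph_prod normr_prod.
by apply: eq_bigr => i _; rewrite mxE.
Qed.

Lemma pairing_continuous (w : 'rV[R]_n) : continuous (pairing w).
Proof.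
apply: (@continuous_big _ _ _ _ _ (@add_continuous R)) => k _ y.
by apply: (@cvgMl_tmp _ _ (nbhs y)); exact: coord_continuous.
Qed.

Lemma borel_hyperplane (w : 'rV[R]_n) (c : R) :
  measurable ([set x | pairing w x = c] : set borel).
Proof.
apply: borel_closed; apply: (@closed_comp _ _ (pairing w) [set c]);
  last exact: closed_eq.
by move=> x _; exact: pairing_continuous.
Qed.

Lemma Vol_hyperplane (w : 'rV[R]_n) (c : R) : w != 0 ->
  Vol [set x | pairing w x = c] = 0%E.
Proof.
move=> w0; have [i wi] : exists i, w 0 i != 0.
  apply: contrapT => h; move/eqP: w0; apply; apply/rowP => i; rewrite mxE.
  by apply: contrapT => wi; apply: h; exists i; exact/eqP.
set H := [set x | _].
(* As [w 0 i] is nonzero, moving along [e] changes the value of [pairing w], so distinct translates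
   of [H] along [e] are disjoint. *)
pose e : 'rV[R]_n := delta_mx 0 i.
have pD x y : pairing w (x + y) = pairing w x + pairing w y.
  by rewrite -big_split; apply: eq_bigr => k _; rewrite mxE mulrDr.
have pe t : pairing w (t *: e) = t * w 0 i.
  rewrite /pairing (bigD1 i)//= big1 ?addr0.
    by rewrite !mxE !eqxx mulr1 mulrC.
  by move=> k /negPf ki; rewrite !mxE eqxx/= ki !mulr0.
have mH : measurable (H : set borel) by exact: borel_hyperplane.
(* The piece must be bounded so that its translates by [t j *: e], with [0 < t j <= 1], all stay in
   one box of finite volume. *)
suff null (N : nat) : Vol (H `&` box (const_mx (- N%:R)) (const_mx N%:R)) = 0%E.
  apply/eqP; rewrite eq_le Vol_ge0 andbT.
  have /Vol_esum_le : H `<=` \bigcup_(N in [set: nat])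
      (H `&` box (const_mx (- N%:R)) (const_mx N%:R)).
    move=> x Hx; pose N := (\sum_i Num.truncn `|x 0%R i|).+1.
    exists N => //; split => // k; rewrite !mxE.
    have : `|x 0 k| < N%:R.
      apply: (lt_le_trans (truncnS_gt _)); rewrite ler_nat ltnS.
      by rewrite (bigD1 k)//= leq_addr.
    by rewrite ltr_norml => /andP[-> /ltW].
  by move=> /le_trans; apply; rewrite esum1.
set HN := _ `&` _; apply/eqP; rewrite eq_le Vol_ge0 andbT.
pose B : set 'rV[R]_n := box (const_mx (- N%:R - 1)) (const_mx (N%:R + 1)).
have mHN : measurable (HN : set borel).
  by apply: measurableI => //; exact: borel_box.
pose t (j : nat) : R := j.+1%:R^-1.
(* infinitely many disjoint translates of [HN] fit in the bounded box [B] *)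
have le : (\sum_(j <oo) Vol HN <= Vol B)%E.
  rewrite (eq_eseriesr (g := fun j => Vol [set x | HN (x - t j *: e)])); last first.
    by move=> j _; rewrite Vol_shift.
  rewrite -(@measure_semi_bigcup _ _ _ leb (fun j => [set x | HN (x - t j *: e)])).
  - apply: le_Vol => x [j _ [_ xb]] k; have := xb k; rewrite !mxE eqxx/=.
    have : 0 <= t j * (k == i)%:R <= 1.
      case: (k == i); rewrite ?mulr0 ?mulr1 ?lexx ?ler01//.
      by rewrite invr_ge0 ler0n invf_le1 ?ler1n ?ltr0n.
    by move: (t j * _) => s; lra.
  - by move=> j; exact: borel_shift.
  - apply/trivIsetP => j k _ _ jk; rewrite -subset0 => x [[+ _] [+ _]].
    rewrite /H /= !pD -!scaleNr !pe => h1 h2; move/eqP: jk; apply.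
    have /eqP : j.+1%:R = k.+1%:R :> R.
      apply/invr_inj/oppr_inj/(mulIf wi)/(addrI (pairing w x)).
      by rewrite h1 h2.
    by rewrite eqr_nat => /eqP[].
  - by apply: bigcup_measurable => j _; exact: borel_shift.
have HNB : (Vol HN <= Vol B)%E.
  apply: le_Vol => x [_ xb] k; have := xb k.
  by rewrite !mxE; lra.
move: le HNB; rewrite /B Vol_box; move: (box_volume _ _) => V.
case: (Vol HN) (Vol_ge0 HN) => [r| |]//; rewrite !lee_fin => r0 le _.
rewrite leNgt; apply/negP => {}r0.
(* Since [k] exceeds [V / r], already [k] translates of volume [r] exceed [V]. *)
pose k := (Num.truncn (V / r)).+1.
have : (\sum_(0 <= j < k) r%:E <= V%:E)%E.
  apply: le_trans le; apply: (@nneseries_lim_ge _ (fun=> r%:E) xpredT 0%N k).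
  by move=> *; rewrite lee_fin ltW.
rewrite sumEFin sumr_const_nat subn0 lee_fin -mulr_natl -ler_pdivlMr//.
by rewrite leNgt truncnS_gt.
Qed.

End LinearInt.

(** * The form Z and the function phi *)

Section Form.
Context {R : realType} {n : nat} (Z : {dot 'rV[R]_n for idfun}).
Implicit Types (u v x y : 'rV[R]_n) (E : set 'rV[R]_n).

Local Notation q := (quad Z).
Local Notation ZM := (matrix_of_form Z).

Lemma dotC u v : Z u v = Z v u.
Proof. by rewrite hermC/= expr0 mul1r. Qed.

Lemma dot_ge0 u : 0 <= Z u u.
Proof.
have [->|u0] := eqVneq u 0; first by rewrite linear0r.
by rewrite ltW// neq0_dnorm_gt0.
Qed.

Lemma dot_le0 u : Z u u <= 0 -> u = 0.
Proof. by move=> uu; apply: contraTeq uu => u0; rewrite -ltNge neq0_dnorm_gt0. Qed.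

Lemma quadD x y : q (x + y) = q x + Z x y + q y.
Proof.
rewrite /quad linearDl !linearDr/= (dotC y x).
by move: (Z _ _) (Z _ _) (Z _ _) => a b c; lra.
Qed.

Lemma dotDl u v w : Z (u + v) w = Z u w + Z v w.
Proof. exact: linearDl. Qed.

Lemma dot0r u : Z u 0 = 0.
Proof. exact: linear0r. Qed.

Lemma dotBr u v w : Z w (u - v) = Z w u - Z w v.
Proof. exact: linearBr. Qed.

Lemma dotBl u v w : Z (u - v) w = Z u w - Z v w.
Proof. exact: linearBl. Qed.

Lemma dotZl t u v : Z (t *: u) v = t * Z u v.
Proof. by rewrite linearZl_LR. Qed.

Lemma dotZr t u v : Z u (t *: v) = t * Z u v.
Proof. by rewrite linearZr_LR. Qed.

Lemma dot_sumr u (F : 'I_n -> 'rV[R]_n) : Z u (\sum_i F i) = \sum_i Z u (F i).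
Proof. exact: linear_sumr. Qed.

Lemma quadZ (t : R) x : q (t *: x) = t ^+ 2 * q x.
Proof. by rewrite /quad dotZl dotZr; ring. Qed.

Lemma quadN x : q (- x) = q x.
Proof. by rewrite -scaleN1r quadZ sqrrN expr1n mul1r. Qed.

Lemma quadB x y : q (x - y) = q x - Z x y + q y.
Proof. by rewrite quadD quadN -[- y]scaleN1r dotZr mulN1r. Qed.

(** In the dual basis, the covector [Z u] has coordinates [u *m ZM]; the lemma moves between the
    form and the pairing. *)
Lemma pairing_dot u y : pairing (u *m ZM) y = Z u y.
Proof.
rewrite [y in RHS]row_sum_delta dot_sumr; apply: eq_bigr => j _.
rewrite dotZr mulrC; congr (_ * _); rewrite mxE.
rewrite dotC [u in RHS]row_sum_delta dot_sumr; apply: eq_bigr => i _.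
by rewrite dotZr mxE dotC.
Qed.

Lemma dot_eq0 u : u *m ZM = 0 -> u = 0.
Proof.
move=> u0; apply: dot_le0; rewrite -pairing_dot u0.
by rewrite /pairing big1// => i _; rewrite mxE mul0r.
Qed.

Lemma dot_unitmx : ZM \in unitmx.
Proof.
rewrite -row_free_unit -kermx_eq0; apply/eqP/row_matrixP => i.
by rewrite row0; apply: dot_eq0; rewrite -row_mul mulmx_ker row0.
Qed.

(* The characteristic polynomial of [- ZM] has no root in [0, +oo[, so its
   value [\det ZM] at 0 has the sign of its leading term. *)
Lemma dot_det_gt0 : 0 < \det ZM.
Proof.
pose p := char_poly (- ZM).
have pE (x : R) : p.[x] = \det (x%:M + ZM).
  rewrite /p /char_poly -horner_evalE -det_map_mx; congr (\det _).
  by apply/matrixP => i j; rewrite !mxE /= /horner_eval !hornerE; case: eqP;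
    rewrite ?mulr1n ?mulr0n ?hornerX ?hornerC ?opprK.
have p0 (x : R) : 0 <= x -> p.[x] != 0.
  move=> x0; rewrite pE -unitfE -unitmxE -row_free_unit -kermx_eq0.
  apply/eqP/row_matrixP => i; rewrite row0; set u := row i _.
  have u0 : u *m (x%:M + ZM) = 0 by rewrite -row_mul mulmx_ker row0.
  apply: dot_le0; rewrite -pairing_dot.
  (* A root [x >= 0] would make [u] an eigenvector with eigenvalue [- x], so that [Z u u] is [- x]
     times a sum of squares. *)
  have -> : u *m ZM = - x *: u.
    by move/eqP: u0; rewrite mulmxDr mul_mx_scalar addrC addr_eq0 scaleNr => /eqP.
  rewrite /pairing; apply: sumr_le0 => k _.
  by rewrite mxE -mulrA mulNr oppr_le0 mulr_ge0// -expr2 sqr_ge0.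
have pm : p \is monic by exact: char_poly_monic.
have lc : 0 < lead_coef p by rewrite (eqP pm).
have [N pN] := polyrcf.poly_pinfty_gt_lc lc.
rewrite ltNge; apply/negP => det0.
have [||x /andP[x0 _] px] := @poly_ivt R p 0 (Num.max N 0).
- by rewrite le_max lexx orbT.
- rewrite pE raddf0 add0r det0/= (le_trans (ltW lc))// pN// le_max lexx//.
- by move/negP: (p0 x x0).
Qed.

Lemma subdiff_quad y : subdiff q y = [set y *m ZM].
Proof.
apply/seteqP; split=> [u uy|_ -> x] /=.
  pose v := (u - y *m ZM) *m invmx ZM.
  have vE : v *m ZM = u - y *m ZM by rewrite mulmxKV// dot_unitmx.
  suff v0 : v = 0 by move/eqP: vE; rewrite v0 mul0mx eq_sym subr_eq0 => /eqP.
  (* Tested at [v + y], the subgradient inequality reads [Z v v <= Z v v / 2]. *)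
  apply: dot_le0; have := uy (v + y); rewrite addrK quadD.
  have -> : u = (v + y) *m ZM by rewrite mulmxDl vE subrK.
  rewrite pairing_dot dotDl (dotC y v) /quad.
  by move: (Z v v) (Z v y) (Z y y) => a b c; lra.
rewrite pairing_dot -[x in leRHS](subrK y) quadD (dotC (x - y) y).
rewrite -[leRHS]addrA lerDr.
by rewrite /quad mulr_ge0// dot_ge0.
Qed.

Hypothesis Z_int : forall m m', lattice m -> lattice m' -> Z m m' \is a Num.int.

Lemma dot_int_mx : exists M : 'M[int]_n, ZM = map_mx intr M.
Proof.
exists (\matrix_(i, j) Num.floor (ZM i j)); apply/matrixP => i j; rewrite !mxE.
rewrite floorK//; apply: Z_int => k; rewrite mxE; exact: natr_int.
Qed.

Lemma Vol_lin_dot E : Vol (lin ZM E) = ((\det ZM)%:E * Vol E)%E.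
Proof.
have [M ZE] := dot_int_mx; have := dot_det_gt0; rewrite ZE det_map_mx => M0.
by rewrite Vol_lin_int ?gtr0_norm// -(intr_eq0 R) gt_eqF.
Qed.

Lemma MA_quad E : MA q E = ((\det ZM)%:E * Vol E)%E.
Proof.
rewrite -Vol_lin_dot; congr Vol; apply/seteqP; split=> [u [y Ey]|_ [y Ey <-]].
  by rewrite subdiff_quad => ->; exists y.
by exists y => //; rewrite subdiff_quad.
Qed.

End Form.

Lemma convex_setP (R : realType) (V : lmodType R) (A : set V) :
  @convex_set R V A <-> forall (t : R) x y, 0 <= t <= 1 -> A x -> A y ->
    A (t *: x + (1 - t) *: y).
Proof.
split=> [cA t x y /andP[t0 t1] Ax Ay|cA x y l /set_mem Ax /set_mem Ay].
  by have /(_ (Itv01 t0 t1) (mem_set Ax) (mem_set Ay))/set_mem := cA x y.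
by apply/mem_set; apply: cA => //; rewrite ge0 le1.
Qed.

(** * The lower hull function: convexity, quasi-periodicity, distance to the quadratic form *)

Section Hull.
Context {R : realType} {n : nat} (Z : {dot 'rV[R]_n for idfun}).
Variable phi : 'rV[R]_n -> R.
Implicit Types (u v x y m : 'rV[R]_n) (E : set 'rV[R]_n).

Local Notation q := (quad Z).
Local Notation ZM := (matrix_of_form Z).
Local Notation hull :=
  (convex_hull [set ((m, q m) : 'rV[R]_n * R^o) | m in lattice]).

Hypothesis phi_hull : graph phi = lower_boundary hull.

(** The induction principle for the hull. Since [(y, phi y)] lies in the hull, a fact about [phi]
    follows once it is phrased as a convex [P] that contains the lifted lattice points. *)
Lemma hull_min (P : set ('rV[R]_n * R^o)) :
  (forall t p p', 0 <= t <= 1 -> P p -> P p' -> P (t *: p + (1 - t) *: p')) ->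
  (forall m, lattice m -> P (m, q m)) -> hull `<=` P.
Proof.
move=> Pconv PA; apply: smallest_sub => [|_ [m mL <-]]; last exact: PA.
exact/convex_setP.
Qed.

Lemma hull_conv t p p' : 0 <= t <= 1 -> hull p -> hull p' ->
  hull (t *: p + (1 - t) *: p').
Proof.
move=> t01 Hp Hp' C [cC AC].
by move/convex_setP : (cC); apply => //; [exact: Hp|exact: Hp'].
Qed.

Lemma hull_lattice m : lattice m -> hull (m, q m).
Proof. by move=> mL; apply: sub_gen_smallest; exists m. Qed.

Lemma phi_in_hull y : hull (y, phi y).
Proof.
by have : graph phi (y, phi y) by []; rewrite phi_hull => -[].
Qed.

Lemma phi_le y (t : R) : hull (y, t) -> phi y <= t.
Proof.
have : graph phi (y, phi y) by [].
by rewrite phi_hull => -[_ /= h]; exact: h.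
Qed.

Lemma phi_convex t x y : 0 <= t <= 1 ->
  phi (t *: x + (1 - t) *: y) <= t * phi x + (1 - t) * phi y.
Proof.
move=> t01; apply: phi_le.
exact: (hull_conv t01 (phi_in_hull x) (phi_in_hull y)).
Qed.

Lemma quad_ge0 x : 0 <= q x.
Proof. by rewrite mulr_ge0// dot_ge0. Qed.

Lemma quad_convex t x y : 0 <= t <= 1 ->
  q (t *: x + (1 - t) *: y) <= t * q x + (1 - t) * q y.
Proof.
(* This is exactly the difference of the two sides. *)
move=> t01; have : 0 <= t * (1 - t) * q (x - y).
  case/andP: t01 => t0 t1; apply: mulr_ge0; last exact: quad_ge0.
  by rewrite mulr_ge0// subr_ge0.
rewrite quadB quadD !quadZ dotZr dotZl => h; rewrite -subr_ge0; apply: (le_trans h).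
by rewrite le_eqVlt; apply/orP; left; apply/eqP; ring.
Qed.

Lemma quad_le_phi y : q y <= phi y.
Proof.
apply: (hull_min (P := [set p | q p.1 <= p.2]) _ _ (phi_in_hull y)) => //=.
move=> t p p' t01 /= hp hp'; apply: (le_trans (quad_convex _ _ t01)).
by case/andP: t01 => t0 t1; apply: lerD; apply: ler_wpM2l; rewrite ?subr_ge0.
Qed.

Lemma phi_lattice m : lattice m -> phi m = q m.
Proof.
move=> mL; apply/eqP; rewrite eq_le quad_le_phi andbT.
by apply: phi_le; exact: hull_lattice.
Qed.

Lemma latticeD m m' : lattice m -> lattice m' -> lattice (m + m').
Proof. by move=> mL mL' i; rewrite mxE rpredD. Qed.

Lemma latticeN m : lattice m -> lattice (- m).
Proof. by move=> mL i; rewrite mxE rpredN. Qed.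

(** The affine map sending [(y, s)] to [(y + g, s + Z g y + q g)] permutes the lifted lattice
    points, hence maps the hull into itself. *)
Lemma phi_shift_le g y : lattice g -> phi (y + g) <= phi y + Z g y + q g.
Proof.
move=> gL; apply: phi_le.
apply: (hull_min (P := [set p | hull (p.1 + g, p.2 + Z g p.1 + q g : R^o)])
  _ _ (phi_in_hull y)) => /= [t p p' t01 hp hp'|m mL].
  have := hull_conv t01 hp hp'; congr hull; congr pair => /=.
    by rewrite !scalerDr addrACA -scalerDl [t + _]addrC subrK scale1r.
  by rewrite linearDr/= !dotZr /GRing.scale/=; ring.
rewrite (_ : q m + _ + _ = q (m + g)); last by rewrite quadD dotC.
by apply: hull_lattice; exact: latticeD.
Qed.

Lemma phi_shift g y : lattice g -> phi (y + g) = phi y + Z g y + q g.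
Proof.
move=> gL; apply/eqP; rewrite eq_le phi_shift_le//=.
(* The reverse inequality is the same bound at [y + g] for the shift [- g]. *)
have := phi_shift_le (y + g) (latticeN gL); rewrite addrK.
rewrite quadN.
rewrite -[in Z _ _]scaleN1r dotZl linearDr/= -[Z g g](_ : q g + q g = _).
  by lra.
by rewrite /quad; lra.
Qed.

Lemma phi_sub_quad_periodic g y : lattice g ->
  phi (y + g) - q (y + g) = phi y - q y.
Proof. by move=> gL; rewrite phi_shift// quadD dotC; ring. Qed.

(** By convexity [phi] on the closed cube is bounded through its values at the corners; their sum
    serves as a bound because they are nonnegative. In the induction, [j] counts the leading
    coordinates still free, the others being 0 or 1. *)
Lemma phi_cube_le :
  exists C : R, forall x, (forall i, 0 <= x 0 i <= 1) -> phi x <= C.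
Proof.
pose corner (c : {ffun 'I_n -> bool}) : 'rV[R]_n := \row_i (c i)%:R.
exists (\sum_c q (corner c)) => x; set C := \sum_c _.
suff le (j : nat) y : (forall i, 0 <= y 0 i <= 1) ->
    (forall i : 'I_n, (j <= i)%N -> y 0 i = 0 \/ y 0 i = 1) -> phi y <= C.
  by move=> x01; apply: (le n) => // i; rewrite leqNgt ltn_ord.
elim: j y => [|j IH] y y01 yint.
  pose c := [ffun i => y 0 i == 1].
  have -> : y = corner c.
    apply/rowP => i; rewrite mxE ffunE.
    by have [->|->] := yint i isT; rewrite ?eqxx// eq_sym oner_eq0.
  rewrite phi_lattice; last by move=> i; rewrite mxE natr_int.
  by rewrite /C (bigD1 c)//= lerDl sumr_ge0// => *; exact: quad_ge0.
have [jn|nj] := ltnP j n; last first.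
  by apply: IH => // i ji; have := ltn_ord i; rewrite ltnNge (leq_trans nj ji).
pose i0 := Ordinal jn.
pose y_ (a : R) : 'rV[R]_n := \row_i if i == i0 then a else y 0 i.
have -> : y = y 0 i0 *: y_ 1 + (1 - y 0 i0) *: y_ 0.
  apply/rowP => i; rewrite !mxE; case: eqP => [->|_]; ring.
apply: (le_trans (phi_convex _ _ (y01 i0))).
have le (a : R) : a = 0 \/ a = 1 -> phi (y_ a) <= C.
  move=> a01; apply: IH => i; rewrite mxE; have [_|ii0] := eqVneq i i0 => //.
    by case: a01 => ->; rewrite ?lexx ?ler01.
  by move=> ji; apply: yint; rewrite ltn_neqAle ji andbT eq_sym.
have /andP[h0 h1] := y01 i0.
have le0 := ler_wpM2l h0 (le 1 (or_intror erefl)).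
have h2 : 0 <= 1 - y 0 i0 by rewrite subr_ge0.
have le1 := ler_wpM2l h2 (le 0 (or_introl erefl)).
by apply: (le_trans (lerD le0 le1)); rewrite -mulrDl addrC subrK mul1r.
Qed.

Lemma phi_sub_quad_bounded :
  exists C : R, forall y, 0 <= phi y - q y <= C.
Proof.
have [C le] := phi_cube_le; exists C => y; rewrite subr_ge0 quad_le_phi/=.
have [z zc] := cube_covering y.
rewrite -(subrK (zvec z) y) phi_sub_quad_periodic; last by apply/latticeP; exists z.
rewrite lerBlDr ler_wpDr ?quad_ge0// le// => i.
by have := zc i; rewrite !mxE => /andP[/ltW -> ->].
Qed.

End Hull.

(** * Monge-Ampere measure of phi *)

Section Cells.
Context {R : realType} {n : nat} (Z : {dot 'rV[R]_n for idfun}).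
Implicit Types (u v x y m : 'rV[R]_n) (E : set 'rV[R]_n).

Local Notation q := (quad Z).
Local Notation ZM := (matrix_of_form Z).

(* In the coordinates [v] with [u = v *m ZM] this is the Voronoi cell of [m]:
   the condition reads [Z (v - m) (v - m) <= Z (v - m') (v - m')]. *)
Definition cell m : set 'rV[R]_n :=
  [set u | forall m', lattice m' -> pairing u (m' - m) + q m <= q m'].

(** Every overlap of two cells lies here. No minimality of the tied values is demanded: the set is
    larger than the overlaps but is plainly a countable union of hyperplanes, indexed by pairs of
    integer vectors. *)
Definition ties : set 'rV[R]_n :=
  [set u | exists z z' : 'rV[int]_n, z != z' /\
    q (zvec z) - pairing u (zvec z) = q (zvec z') - pairing u (zvec z')].

Lemma pairingC u v : pairing u v = pairing v u.
Proof. by apply: eq_bigr => i _; rewrite mulrC. Qed.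

Lemma pairingDr u x y : pairing u (x + y) = pairing u x + pairing u y.
Proof. by rewrite -big_split; apply: eq_bigr => i _; rewrite mxE mulrDr. Qed.

Lemma pairingZr u (t : R) x : pairing u (t *: x) = t * pairing u x.
Proof.
by rewrite /pairing mulr_sumr; apply: eq_bigr => i _; rewrite mxE mulrCA.
Qed.

Lemma pairingBr u x y : pairing u (x - y) = pairing u x - pairing u y.
Proof. by rewrite pairingDr -scaleN1r pairingZr mulN1r. Qed.

Lemma pairingBl u v x : pairing (u - v) x = pairing u x - pairing v x.
Proof. by rewrite !(pairingC _ x) pairingBr. Qed.

Lemma ties_bigcup : ties =
  \bigcup_(p in [set p : 'rV[int]_n * 'rV[int]_n | p.1 != p.2])
    [set u | pairing (zvec p.1 - zvec p.2) u = q (zvec p.1) - q (zvec p.2)].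
Proof.
apply/seteqP; split=> [u [z [z' [zz' e]]]|u [[z z'] /= zz' e]].
  by exists (z, z') => //=; rewrite pairingBl !(pairingC _ u); lra.
exists z, z'; split=> //; move: e; rewrite pairingBl !(pairingC _ u) => e; lra.
Qed.

Lemma Vol_ties : Vol ties = 0%E.
Proof.
rewrite ties_bigcup; apply/eqP; rewrite eq_le Vol_ge0 andbT.
apply: (le_trans (Vol_esum_le (fun x => id))); rewrite esum1// => p pp.
by apply: Vol_hyperplane; rewrite subr_eq0 (inj_eq zvec_inj).
Qed.

Lemma borel_ties : measurable (ties : set borel).
Proof.
rewrite ties_bigcup bigcup_mkcond.
apply: countable_bigcupT_measurable => [|p]; first exact: countableP.
by case: ifP => // _; exact: borel_hyperplane.
Qed.

Lemma borel_cell m : measurable (cell m : set borel).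
Proof.
apply: borel_closed.
have -> : cell m = \bigcap_(m' in lattice) pairing (m' - m) @^-1`
    [set s | s <= q m' - q m].
  apply/seteqP; split=> [u uc m' /uc|u uc m' /uc] /=;
    by rewrite (pairingC u) => h; lra.
apply: closed_bigI => m' _; apply: closed_comp; last exact: closed_le.
by move=> x _; exact: pairing_continuous.
Qed.

Lemma cells_ties u m m' : lattice m -> lattice m' -> m != m' ->
  cell m u -> cell m' u -> ties u.
Proof.
move=> /latticeP[z ->] /latticeP[z' ->]; rewrite (inj_eq zvec_inj) => zz' cm cm'.
exists z, z'; split => //.
have := cm (zvec z'); have := cm' (zvec z); rewrite !pairingBr.
move=> /(_ (proj2 (latticeP _) (ex_intro _ _ erefl))) h1.
move=> /(_ (proj2 (latticeP _) (ex_intro _ _ erefl))) h2.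
lra.
Qed.

(** Translation by [m'] changes [q] by an affine function with linear part [m' *m ZM], so it carries
    cells to cells. *)
Lemma cell_shift m m' u : lattice m' -> cell m (u - m' *m ZM) -> cell (m + m') u.
Proof.
move=> mL uc m'' mL''; have := uc (m'' - m') (latticeD mL'' (latticeN mL)).
have [w ->] : exists w, m'' = w + m + m'.
  by exists (m'' - m' - m); rewrite !subrK.
rewrite !addrK -[w + m + m']addrA addrK pairingBl pairing_dot.
by rewrite addrA !quadD dotDl (dotC Z m' w); lra.
Qed.

Lemma dot_CauchySchwarz u v : Z u v ^+ 2 <= Z u u * Z v v.
Proof.
have [->|v0] := eqVneq v 0; first by rewrite !dot0r expr0n mulr0.
have vv : 0 < Z v v by exact: neq0_dnorm_gt0.
(* This square is [Z v v] times the difference of the two sides. *)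
have := dot_ge0 Z (Z v v *: u - Z u v *: v).
rewrite dotBl !dotBr !dotZl !dotZr (dotC _ v u).
move: (Z u u) (Z u v) (Z v v) vv => a b c c0 h.
rewrite -subr_ge0 -(pmulr_rge0 _ c0); apply: (le_trans h).
by rewrite le_eqVlt; apply/orP; left; apply/eqP; ring.
Qed.

(** The i-th coordinate is [Z w x] for a suitable [w], so Cauchy-Schwarz applies; the factor 2 comes
    from [Z x x = 2 * q x]. This makes the sublevel sets of [q] bounded. *)
Lemma dot_coord_bound (i : 'I_n) : exists K : R, forall x, x 0 i ^+ 2 <= K * q x.
Proof.
pose w := 'e_i *m invmx ZM : 'rV[R]_n.
exists (2 * Z w w) => x; rewrite (_ : x 0 i = Z w x).
  by apply: (le_trans (dot_CauchySchwarz _ _)); rewrite /quad; lra.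
rewrite -pairing_dot mulmxKV ?dot_unitmx// /pairing (bigD1 i)//= big1.
  by rewrite mxE !eqxx mul1r addr0.
by move=> k /negPf ki; rewrite mxE eqxx/= ki mul0r.
Qed.

(** [u] lies in the cell of any minimizer of [f] over the integer vectors. Completing the square,
    [f z = q (zvec z - v) - q v], reduces the existence of a minimizer to a finite search. *)
Lemma cell_covering u : exists z, cell (zvec z) u.
Proof.
pose f (z : 'rV[int]_n) := q (zvec z) - pairing u (zvec z).
pose v := u *m invmx ZM.
have uE : u = v *m ZM by rewrite mulmxKV// dot_unitmx.
have fE z : f z = q (zvec z - v) - q v.
  rewrite /f uE pairing_dot quadB (dotC _ v); ring.
have /choice[K KP] := dot_coord_bound.
(* From [|z_i| <= |z_i - v_i| + |v_i|] and [a <= 1 + a^2]; the sum over the coordinates bounds all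
   of them at once. *)
pose C := \sum_i (1 + `|v 0 i| + `|K i| * q v).
have q0 : 0 <= q v by rewrite mulr_ge0// dot_ge0.
have term0 i : 0 <= 1 + `|v 0 i| + `|K i| * q v.
  by apply: addr_ge0; [exact: addr_ge0|exact: mulr_ge0].
pose N := (Num.truncn C).+1.
have C0 : 0 <= C by apply: sumr_ge0.
(* the sublevel set [f z <= f 0] lies in a finite box *)
have bnd z i : f z <= 0 -> `|(z 0 i)%:~R| <= N%:R :> R.
  rewrite fE subr_le0 => zv.
  have : (zvec z - v) 0 i ^+ 2 <= `|K i| * q v.
    apply: (le_trans (KP _ _)); apply: (@le_trans _ _ (`|K i| * q (zvec z - v))).
      by rewrite ler_wpM2r ?ler_norm// mulr_ge0// dot_ge0.
    by rewrite ler_wpM2l.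
  have le : 1 + `|v 0 i| + `|K i| * q v <= N%:R.
    apply: (@le_trans _ _ C); last exact: ltW (truncnS_gt _).
    by rewrite /C (bigD1 i)//= lerDl sumr_ge0.
  have -> : (zvec z - v) 0 i = (z 0 i)%:~R - v 0 i by rewrite !mxE.
  move=> h; apply: le_trans le.
  have := ler_normD ((z 0 i)%:~R - v 0 i) (v 0 i); rewrite subrK.
  move: h; rewrite -real_normK ?num_real//.
  move: `|(z 0 i)%:~R - v 0 i| `|v 0 i| (`|K i| * _) `|(z 0 i)%:~R|.
  move=> a b c d h; have := sqr_ge0 (a - 1); have := sqr_ge0 a.
  by rewrite sqrrB1; lra.
(* Enumerates the integer vectors with all coordinates between [-N] and [N]. *)
pose g (s : {ffun 'I_n -> 'I_(N.*2.+1)}) : 'rV[int]_n :=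
  \row_i ((s i)%:Z - N%:Z).
have gP z : f z <= 0 -> exists s, g s = z.
  move=> /bnd zN; have zN' i : `|z 0 i| <= N%:Z.
    by rewrite -(ler_int R) intr_norm; exact: zN.
  have lt i : (absz (z 0 i + N%:Z)%R < N.*2.+1)%N.
    by have := zN' i; rewrite -addnn; lia.
  exists [ffun i => Ordinal (lt i)]; apply/rowP => i; rewrite mxE ffunE/=.
  by have := zN' i; lia.
have f0 : f 0 = 0.
  rewrite /f zvec0 pairingC /quad dot0r /pairing big1 ?mulr0 ?subr0// => i _.
  by rewrite mxE mul0r.
have [s0 gs0] : exists s, g s = 0 by apply: gP; rewrite f0.
have [s _ smin] := @arg_minP _ _ _ s0 xpredT (f \o g) isT.
exists (g s) => _ /latticeP[z ->].
suff : f (g s) <= f z by rewrite /f pairingBr; lra.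
have [/gP[s' <-]|fz] := leP (f z) 0; first exact: smin.
by rewrite (le_trans (smin s0 isT))//= gs0 f0 ltW.
Qed.

Lemma Vol_setD_ties E : Vol (E `\` ties) = Vol E.
Proof.
apply/eqP; rewrite eq_le le_Vol//=.
rewrite -[leRHS]adde0 -Vol_ties; apply: le_trans (outer_measureU2 (@Vol R n) _ _).
by apply: le_Vol => x Ex; have [|] := pselect (ties x); [right|left].
Qed.

Lemma lattice_zvec z : lattice (zvec z : 'rV[R]_n).
Proof. by apply/latticeP; exists z. Qed.

(** The cell is a fundamental domain only up to a null set: without [ties] it packs, with its
    boundary it covers. Each property gives one inequality against the image of the cube, which does
    both. *)
Lemma Vol_cell0 : Vol (cell 0) = Vol (lin ZM cube).
Proof.
have Zu := dot_unitmx Z.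
have mc : measurable (lin ZM cube : set borel).
  by apply: borel_lin => //; exact: borel_box.
have m0 := borel_cell 0.
have mP : measurable (cell 0 `\` ties : set borel).
  by apply: measurableD => //; exact: borel_ties.
have L0 : lattice (0 : 'rV[R]_n) by rewrite -zvec0; exact: lattice_zvec.
have LN z : lattice (- zvec z : 'rV[R]_n) by exact/latticeN/lattice_zvec.
apply/eqP; rewrite eq_le; apply/andP; split.
  rewrite -Vol_setD_ties; apply: (le_Vol_packing_covering Zu) => //.
    move=> z x [xc xt] [xzc _]; apply: contrapT => /eqP z0; apply: xt.
    apply: (cells_ties L0 (LN z) _ xc).
      by rewrite eq_sym oppr_eq0 -zvec0 (inj_eq zvec_inj).
    by rewrite -[- _]add0r; apply: cell_shift; rewrite // mulNmx opprK.
  by move=> x _; exact: lin_cube_covering.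
apply: (le_Vol_packing_covering Zu) => //.
  by move=> z x; exact: lin_cube_packing.
move=> x _; have [z zx] := cell_covering x; exists z.
by rewrite -(subrr (zvec z)); apply: cell_shift; rewrite // mulNmx opprK subrK.
Qed.

Hypothesis Z_int : forall m m', lattice m -> lattice m' -> Z m m' \is a Num.int.

Lemma Vol_cell m : lattice m -> Vol (cell m) = (\det ZM)%:E.
Proof.
move=> mL; rewrite -[RHS]mule1 -(@Vol_cube R n) -Vol_lin_dot// -Vol_cell0.
rewrite -(Vol_shift (cell 0) (m *m ZM)).
congr Vol; apply/seteqP; split=> u /= um.
  rewrite -(subrr m); apply: cell_shift; first exact: latticeN.
  by rewrite mulNmx opprK subrK.
by rewrite -[m]add0r; exact: cell_shift.
Qed.

End Cells.

(** * Subgradients of the hull function *)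

Section MAphi.
Context {R : realType} {n : nat} (Z : {dot 'rV[R]_n for idfun}).
Variable phi : 'rV[R]_n -> R.
Implicit Types (u x y m : 'rV[R]_n) (E : set 'rV[R]_n).

Local Notation q := (quad Z).
Local Notation ZM := (matrix_of_form Z).

Hypothesis Z_int : forall m m', lattice m -> lattice m' -> Z m m' \is a Num.int.
Hypothesis phi_hull : graph phi = lower_boundary
  (convex_hull [set ((m, q m) : 'rV[R]_n * R^o) | m in lattice]).

(** The region above an affine function is convex, so its inequality passes from the lifted lattice
    points to the whole hull, and so to the graph of [phi]. *)
Lemma subdiff_lattice m : lattice m -> subdiff phi m = cell Z m.
Proof.
move=> mL; apply/seteqP; split=> [u um m' mL'|u um y].
  by have := um m'; rewrite !(phi_lattice phi_hull).
rewrite (phi_lattice phi_hull mL).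
apply: (hull_min (P := [set p | pairing u (p.1 - m) + q m <= p.2]) _ _
  (phi_in_hull phi_hull y)) => /= [t p p' /andP[t0 t1] hp hp'|m' mL']; last first.
  exact: um.
have t1' : 0 <= 1 - t by rewrite subr_ge0.
apply: le_trans (lerD (ler_wpM2l t0 hp) (ler_wpM2l t1' hp')).
rewrite !pairingBr pairingDr !pairingZr.
by rewrite le_eqVlt; apply/orP; left; apply/eqP; ring.
Qed.

(* A subgradient at [y] touches the hull along a face containing [(y, phi y)];
   if the face were a single vertex, [y] would be a lattice point. *)
Lemma subdiff_ties u y : subdiff phi y u -> ~ lattice y -> ties Z u.
Proof.
move=> uy yL; apply: contrapT => ut; apply: yL.
pose h (p : 'rV[R]_n * R^o) : R := p.2 - pairing u p.1.
pose c := phi y - pairing u y.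
(* Either strictly above the supporting hyperplane, or a lifted lattice point on it. This is convex
   because, for [u] outside [ties], at most one lifted lattice point lies on the hyperplane. *)
pose P p := c < h p \/ h p = c /\ lattice p.1 /\ p.2 = q p.1.
have hD t p p' : h (t *: p + (1 - t) *: p') = t * h p + (1 - t) * h p'.
  by rewrite /h /= pairingDr !pairingZr /GRing.scale/=; ring.
have Pge p : P p -> c <= h p by case=> [/ltW//|[->]].
suff /(_ _ (phi_in_hull phi_hull y)) :
    convex_hull [set ((m, q m) : 'rV[R]_n * R^o) | m in lattice] `<=` P.
  by rewrite /P /h /= ltxx => -[//|[_ []]].
apply: hull_min => [t p p' /andP[t0 t1] Pp Pp'|m mL]; last first.
  have : c <= h (m, q m).
    have := uy m; rewrite (phi_lattice phi_hull mL) pairingBr /h /c /=; lra.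
  by rewrite le_eqVlt => /orP[/eqP/esym e|e]; [right|left].
have [->|t_neq0] := eqVneq t 0; first by rewrite scale0r add0r subr0 scale1r.
have [->|t_neq1] := eqVneq t 1; first by rewrite scale1r subrr scale0r addr0.
have t0' : 0 < t by rewrite lt_neqAle eq_sym t_neq0.
have t1' : 0 < 1 - t by rewrite subr_gt0 lt_neqAle t_neq1.
have [hp|hp] := Pp.
  left; rewrite hD; have := Pge _ Pp'; nra.
have [hp'|hp'] := Pp'.
  left; rewrite hD; have := Pge _ Pp; nra.
suff -> : p' = p by rewrite -scalerDl addrC subrK scale1r.
case: p p' hp hp' {Pp Pp'} => [m s] [m' s'] [/= e [mL es]] [e' [mL' es']].
suff mm' : m' = m by rewrite es es' mm'.
apply: contrapT => mm'; apply: ut.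
move: mL mL' => /latticeP[z mz] /latticeP[z' mz'].
exists z, z'; rewrite -mz -mz' -es -es'; split; last first.
  by move: e e'; rewrite /h/= => -> ->.
by apply/eqP => zz'; apply: mm'; rewrite mz mz' zz'.
Qed.

(** Off the null set [ties], only lattice points contribute subgradients, and their cells are
    disjoint. Finiteness matters: a sum with infinite support is 0 by convention. *)
Lemma MA_phi E : finite_set (lattice `&` E) ->
  MA phi E = \sum_(m \in lattice `&` E) (\det ZM)%:E.
Proof.
move=> finE; pose W := \bigcup_(m in lattice `&` E) (cell Z m `\` ties Z).
have mF m : (lattice `&` E) m -> measurable (cell Z m `\` ties Z : set borel).
  by move=> _; apply: measurableD; [exact: borel_cell|exact: borel_ties].
transitivity (Vol W).
  rewrite /MA -(Vol_setD_ties Z); congr Vol; apply/seteqP; split=> u.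
    move=> [[y Ey uy] ut]; have [yL|yL] := pselect (lattice y); last first.
      by have := subdiff_ties uy yL.
    by exists y; [split|split=> //; rewrite -subdiff_lattice].
  move=> [m [mL Em] [um ut]]; split=> //; exists m => //.
  by rewrite subdiff_lattice.
rewrite -[Vol W]/(leb W) measure_fin_bigcup//.
  apply: eq_fsbigr => m /set_mem[mL _].
  by rewrite -(Vol_cell Z_int mL) -(Vol_setD_ties Z (cell Z m)).
apply/trivIsetP => m m' [mL _] [mL' _] mm'; rewrite -subset0 => u.
by move=> [[um ut] [um' _]]; apply: ut; exact: cells_ties um um'.
Qed.

End MAphi.

(** * Measures on the tori *)

Section Torus.
Context {R : realType} {n : nat}.
Implicit Types (x y m : 'rV[R]_n) (k : nat).

Lemma borel_torus_pi k (A : set (torus R n k)) : measurable A ->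
  measurable (torus_pi k @^-1` A : set borel).
Proof.
have mpi : measurable_fun [set: @borel R n] (torus_pi k : borel -> torus R n k).
  apply: (@measurability _ _ borel (torus R n k) _ _ (@open _)) => // _ [B oB <-].
  by rewrite setTI; apply: borel_open.
by move=> mA; rewrite -[X in measurable X]setTI; exact: mpi.
Qed.

Lemma torus_piD k x m : lattice m -> torus_pi k (x + k%:R *: m) = torus_pi k x.
Proof. by move=> mL; apply/torus_piP; exists m => //; rewrite addrC addKr. Qed.

Lemma open_torus_pi k (U : set 'rV[R]_n) : open U -> open (torus_pi k @` U).
Proof.
move=> oU; change (open (torus_pi k @^-1` (torus_pi k @` U))).
have -> : torus_pi k @^-1` (torus_pi k @` U) =
    \bigcup_(m in lattice) ((fun x => x - k%:R *: m) @^-1` U).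
  apply/seteqP; split=> [x [y Uy /esym/torus_piP[m mL e]]|x [m mL Ux]] /=.
    by exists m => //=; rewrite -e subKr.
  exists (x - k%:R *: m) => //.
  by rewrite -scalerN torus_piD//; exact: latticeN.
apply: bigcup_open => m _; apply: open_comp => // x _.
by apply: (@cvgB _ _ _ (nbhs x) _ id (cst _)); [exact: cvg_id|exact: cvg_cst].
Qed.

(** In the sup norm, two points of the ball differ by less than [k] in every coordinate, whereas a
    nonzero vector of kM has a coordinate of size at least [k]. *)
Lemma torus_pi_ball_inj k x : (0 < k)%N ->
  set_inj (ball x (k%:R / 2)) (torus_pi k).
Proof.
move=> k0 y z; have kR : 0 < k%:R / 2 :> R by rewrite divr_gt0// ltr0n.
move=> /set_mem/(ball_rVP _ _ kR) yb /set_mem/(ball_rVP _ _ kR) zb.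
move=> /torus_piP[m /latticeP[u ->] e].
suff u0 : u = 0 by apply/subr0_eq; rewrite e u0 zvec0 scaler0.
apply/rowP => i; rewrite mxE.
have : `|y 0 i - z 0 i| < k%:R.
  rewrite (_ : y 0 i - z 0 i = (x 0 i - z 0 i) - (x 0 i - y 0 i)); last by ring.
  by rewrite (le_lt_trans (ler_normB _ _))// [ltRHS]splitr ltrD.
move/rowP/(_ i) : e; rewrite !mxE => ->.
rewrite normrM ger0_norm// gtr_pMr ?ltr0n// -intr_norm -[1]/(1%:~R) ltr_int.
lia.
Qed.

(** Rounding down to the grid of step [k/4] moves each coordinate by less than [k/4]; the centres
    are thus countably many. *)
Lemma torus_ball_cover k x : (0 < k)%N ->
  exists z : 'rV[int]_n, ball ((k%:R / 4) *: zvec z) (k%:R / 2) x.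
Proof.
move=> k0; pose c : R := k%:R / 4; rewrite -/c.
have -> : k%:R / 2 = 2 * c by rewrite /c; lra.
have c0 : 0 < c by rewrite divr_gt0// ltr0n.
exists (\row_i Num.floor (x 0 i / c)); apply/ball_rVP => [|i].
  by rewrite mulr_gt0.
rewrite !mxE ltr_norml; have := floor_itv (x 0 i / c).
rewrite ler_pdivlMr// ltr_pdivrMr// rmorphD/= mulrDl mul1r [c * _]mulrC.
by move: (_%:~R * c) => a; lra.
Qed.

(** Images of countably many small balls cover the torus. Made disjoint by [seqDU], they cut [A]
    into pieces that lift to Borel sets of a ball, where both measures equal [nu]. *)
Lemma locally_given_unique k (nu : set 'rV[R]_n -> \bar R)
    (mu1 mu2 : {measure set (torus R n k) -> \bar R}) : (0 < k)%N ->
  locally_given nu mu1 -> locally_given nu mu2 ->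
  forall A, measurable A -> mu1 A = mu2 A.
Proof.
move=> k0 nu1 nu2 A mA.
pose e (j : nat) : 'rV[int]_n := odflt 0 (unpickle j).
pose U j : set 'rV[R]_n := ball ((k%:R / 4) *: zvec (e j)) (k%:R / 2).
have oU j : open (U j) by apply: ball_open; rewrite divr_gt0// ltr0n.
pose V j := torus_pi k @` U j.
have mV j : measurable (V j).
  by apply: sub_sigma_algebra; exact: open_torus_pi.
have coverV : \bigcup_j V j = setT.
  rewrite -subTset => b _; have [z zb] := torus_ball_cover (repr b) k0.
  exists (pickle z) => //; exists (repr b); last by rewrite /torus_pi reprK.
  by rewrite /U /e pickleK.
have mW j : measurable (seqDU V j).
  by apply: measurableD => //; exact: bigsetU_measurable.
have AE : A = \bigcup_j (A `&` seqDU V j).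
  by rewrite -setI_bigcupr -seqDU_bigcup_eq coverV setIT.
have tA : trivIset setT (fun j => A `&` seqDU V j).
  exact/trivIset_setIl/trivIset_seqDU.
have mAW j : measurable (A `&` seqDU V j) by exact: measurableI.
rewrite AE !measure_semi_bigcup//; [|by rewrite -AE..].
apply: eq_eseriesr => j _.
set B := _ `&` _.
have BV : B `<=` V j by move=> b [_ []].
pose E := U j `&` torus_pi k @^-1` B.
have -> : B = torus_pi k @` E.
  apply/seteqP; split=> [b Bb|_ [x [_ Bx] <-]//].
  by have [x Ux xb] := BV b Bb; exists x => //; split => //=; rewrite xb.
have mE : <<s open >> E.
  apply: (@measurableI _ (@borel R n)); first exact: borel_open.
  by apply: borel_torus_pi; exact: mAW.
have injU : set_inj (U j) (torus_pi k) by exact: torus_pi_ball_inj.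
have EU : E `<=` U j by move=> x [].
transitivity (nu E); first exact: (nu1 _ (oU j) injU).
by apply/esym; exact: (nu2 _ (oU j) injU).
Qed.

(** Exhibiting any measure locally given by [nu] rules out the dummy branch of [torus_measure]. *)
Lemma torus_measure_given k (nu : set 'rV[R]_n -> \bar R)
    (mu : {measure set (torus R n k) -> \bar R}) :
  locally_given nu mu -> locally_given nu (torus_measure k nu).
Proof.
move=> nu_mu; rewrite /torus_measure; case: pselect => [ex|]; last first.
  by case; exists mu.
exact: projT2 (cid ex).
Qed.

Lemma torus_measureE k (nu : set 'rV[R]_n -> \bar R)
    (mu : {measure set (torus R n k) -> \bar R}) : (0 < k)%N ->
  locally_given nu mu -> forall A, measurable A -> torus_measure k nu A = mu A.
Proof.
move=> k0 nu_mu; apply: (locally_given_unique k0 _ nu_mu).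
exact: torus_measure_given nu_mu.
Qed.

End Torus.

(** * Images of Lebesgue measure on the unit cube *)

Section CubeMeasure.
Context {R : realType} {n : nat} (c : {nonneg R}).
Implicit Types (x y m : 'rV[R]_n) (k : nat) (z : 'rV[int]_n).

Lemma borel_cube : measurable (cube : set (@borel R n)).
Proof. exact: borel_box. Qed.

(** Its total mass is [c], so bounded measurable functions are integrable for it. *)
Definition cube_measure : {measure set (@borel R n) -> \bar R} :=
  mscale c (mrestr leb borel_cube).

Lemma cube_measureE E : cube_measure E = (c%:num%:E * Vol (E `&` cube))%E.
Proof. by []. Qed.

Section Push.
Context d (T : measurableType d) (f : 'rV[R]_n -> T).
Hypothesis mf : measurable_fun [set: @borel R n] (f : borel -> T).

Definition cube_push : {measure set T -> \bar R} :=
  measure_function_pushforward__canonical__measure_function_Measure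
    cube_measure mf.

Lemma cube_pushE E : cube_push E = (c%:num%:E * Vol (f @^-1` E `&` cube))%E.
Proof. by []. Qed.

Lemma integral_cube_push (g : T -> R) (M : R) :
  measurable_fun setT g -> (forall b, `|g b| <= M) ->
  (\int[cube_push]_b (g b)%:E = \int[cube_measure]_x (g (f x))%:E)%E.
Proof.
move=> mg gM; rewrite (@integral_pushforward _ _ _ _ _ _ mf) ?preimage_setT//.
- exact/measurable_EFinP.
apply: measurable_bounded_integrable => //.
- rewrite cube_measureE setTI Vol_cube mule1 ltry//.
- exact: measurableT_comp.
- exists M; split; first exact: num_real.
  by move=> N MN x _ /=; apply: le_trans (gM _) (ltW MN).
Qed.

End Push.

Lemma measurable_torus_pi k :
  measurable_fun [set: @borel R n] (torus_pi k : borel -> torus R n k).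
Proof. by move=> _ A mA; rewrite setTI; exact: borel_torus_pi. Qed.

(** [E] and the part [S] of the cube above its image have the same translates by M. Neither meets
    its own nonzero translates, by injectivity on [U] and by the cube packing, so the packing bound
    applies both ways. *)
Lemma locally_given_cube_push :
  locally_given (fun E => (c%:num%:E * Vol E)%E)
    (cube_push (@measurable_torus_pi 1)).
Proof.
move=> U oU injU E bE EU; rewrite cube_pushE; congr (_ * _)%E.
have mE : measurable (E : set borel) by [].
have piE z x : torus_pi 1 (x + zvec z) = torus_pi 1 x.
  by rewrite -[zvec z]scale1r torus_piD//; exact: lattice_zvec.
set S := _ `&` cube.
have mS : measurable (S : set borel).
  apply: measurableI; last exact: borel_cube.
  have -> : torus_pi 1 @^-1` (torus_pi 1 @` E) =
      \bigcup_(z in [set: 'rV[int]_n]) [set x | E (x - zvec z)].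
    apply/seteqP; split=> [x [y Ey]|x [z _ Ez]].
      move=> /esym/torus_piP[m /latticeP[z ->] e].
      by exists z => //=; rewrite -[zvec z]scale1r -e subKr.
    by exists (x - zvec z) => //; rewrite -zvecN piE.
  apply: countable_bigcupT_measurable => [|z]; first exact: countableP.
  exact: borel_shift.
apply/eqP; rewrite eq_le; apply/andP; split.
  apply: (le_Vol_packing_covering (unitmx1 _ _)) => //.
    by move=> z x [_ xc] [_]; rewrite mulmx1; exact: cube_packing.
  move=> x [[y Ey /esym/torus_piP[m /latticeP[z ->] e]] _]; exists z.
  by rewrite mulmx1 -[zvec z]scale1r -e subKr.
apply: (le_Vol_packing_covering (unitmx1 _ _)) => //.
  move=> z x Ex; rewrite mulmx1 => Exz; apply: zvec_inj; rewrite zvec0.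
  apply: (addrI x); rewrite addr0.
  by apply: injU; rewrite ?piE//; apply/mem_set/EU.
move=> x Ex; have [z zc] := cube_covering x; exists z; rewrite mulmx1.
by split=> //; exists x => //; rewrite -zvecN piE.
Qed.

End CubeMeasure.

(** * Representatives of M / kM and the subdivision of the cube *)

Section Grid.
Context {R : realType} {n : nat}.
Implicit Types (x y m : 'rV[R]_n) (k : nat) (z : 'rV[int]_n).

(** Ceiling, to match the half-open cube: the boxes [grid_box k z] with [z] in [grid k] tile [cube],
    and [grid_ceil k] equals [z] on each. *)
Definition grid_ceil k x : 'rV[int]_n := \row_i Num.ceil (k%:R * x 0 i).

Definition grid k : set 'rV[int]_n := [set z | forall i, 0 < z 0 i <= k%:Z].

Definition grid_box k z : set 'rV[R]_n :=
  box (k%:R^-1 *: (zvec z - const_mx 1)) (k%:R^-1 *: zvec z).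

Lemma grid_boxP k z x : (0 < k)%N -> grid_box k z x <-> grid_ceil k x = z.
Proof.
move=> k0; have kR : 0 < k%:R :> R by rewrite ltr0n.
split=> [xb|<- i].
  apply/rowP => i; rewrite mxE; apply: ceil_def; have := xb i.
  by rewrite !mxE ltr_pdivrMl// ler_pdivlMl// rmorphB.
rewrite !mxE ltr_pdivrMl// ler_pdivlMl//.
by have := ceil_itv (k%:R * x 0 i); rewrite rmorphB.
Qed.

Lemma grid_ceil_preimage k (B : set 'rV[int]_n) : (0 < k)%N ->
  grid_ceil k @^-1` B = \bigcup_(z in B) grid_box k z.
Proof.
move=> k0; apply/seteqP; split=> [x Bx|x [z Bz]]; last first.
  by move/(grid_boxP _ _ k0) => xz; rewrite /= xz.
by exists (grid_ceil k x) => //; apply/grid_boxP.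
Qed.

Lemma borel_grid_ceil k (B : set 'rV[int]_n) : (0 < k)%N ->
  measurable (grid_ceil k @^-1` B : set borel).
Proof.
move=> k0; rewrite grid_ceil_preimage// bigcup_mkcond.
apply: countable_bigcupT_measurable => [|z]; first exact: countableP.
by case: ifP => // _; exact: borel_box.
Qed.

Lemma Vol_grid_box k z : (0 < k)%N -> Vol (grid_box k z) = ((k%:R^-1 : R) ^+ n)%:E.
Proof.
move=> k0; rewrite Vol_box; congr (_%:E).
rewrite -[n in RHS]card_ord -prodr_const; apply: eq_bigr => i _.
rewrite !mxE -mulrBr opprB addrCA subrr addr0 mulr1 max_r//.
Qed.

Lemma finite_grid k : finite_set (grid k).
Proof.
pose g (s : {ffun 'I_n -> 'I_k.+1}) : 'rV[int]_n := \row_i (s i)%:Z.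
apply: (@sub_finite_set _ _ (range g)); last exact/finite_image/finite_finset.
move=> z zk; have lt i : (absz (z 0%R i) < k.+1)%N by have := zk i; lia.
exists [ffun i => Ordinal (lt i)] => //; apply/rowP => i; rewrite mxE ffunE/=.
by have := zk i; lia.
Qed.

Lemma cube_grid_ceil k x : (0 < k)%N -> cube x -> grid k (grid_ceil k x).
Proof.
move=> k0 xc i; rewrite mxE; have := xc i; rewrite !mxE => /andP[x0 x1].
have kR : 0 < k%:R :> R by rewrite ltr0n.
rewrite ceil_gt0 mulr_gt0//= ceil_le_int.
by rewrite -[leRHS]mulr1 (ler_pM2l kR).
Qed.

Lemma grid_box_cube k z : (0 < k)%N -> grid k z -> grid_box k z `<=` cube.
Proof.
move=> k0 zk x xb i; rewrite !mxE; have := xb i; rewrite !mxE.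
have kR : 0 < k%:R :> R by rewrite ltr0n.
have /andP[z0 z1] := zk i.
rewrite ltr_pdivrMl// ler_pdivlMl// => /andP[h1 h2]; apply/andP; split.
  rewrite -(pmulr_rgt0 _ kR); apply: le_lt_trans h1.
  by rewrite subr_ge0 ler1z -gtz0_ge1.
rewrite -(ler_pM2l kR) mulr1; apply: (le_trans h2).
by rewrite -[leRHS]/((k%:Z)%:~R) ler_int.
Qed.

Lemma Vol_grid_ceil k (B : set 'rV[int]_n) : (0 < k)%N ->
  Vol (grid_ceil k @^-1` B `&` cube) =
  \sum_(z \in grid k `&` B) ((k%:R^-1 : R) ^+ n)%:E.
Proof.
move=> k0; have finB : finite_set (grid k `&` B).
  by apply: finite_setIl; exact: finite_grid.
have -> : grid_ceil k @^-1` B `&` cube =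
    \bigcup_(z in grid k `&` B) grid_box k z.
  apply/seteqP; split=> [x [Bx xc]|x [z [zk zB] xb]].
    exists (grid_ceil k x); last exact/grid_boxP.
    by split => //; exact: cube_grid_ceil.
  split; last exact: (grid_box_cube k0 zk).
  by move/(grid_boxP _ _ k0) : xb => /= ->.
rewrite -[LHS]/(leb _) measure_fin_bigcup//.
- by apply: eq_fsbigr => z _; rewrite -[LHS]/(Vol _) Vol_grid_box.
- apply/trivIsetP => z z' _ _ zz'; rewrite -subset0 => x [].
  move=> /(grid_boxP _ _ k0) xz /(grid_boxP _ _ k0) xz'.
  by move/eqP : zz'; apply; rewrite -xz -xz'.
- by move=> z _; exact: borel_box.
Qed.

Lemma grid_torus_bij k : (0 < k)%N ->
  set_bij (grid k) (torus_lattice k) (fun z => torus_pi k (zvec z : 'rV[R]_n)).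
Proof.
move=> k0; have kR : 0 < k%:R :> R by rewrite ltr0n.
split.
- by move=> z _; exists (zvec z) => //; exact: lattice_zvec.
- move=> z z' /set_mem zk /set_mem zk' /torus_piP[m /latticeP[u ->] e].
  apply/rowP => i; move/rowP/(_ i) : e; rewrite !mxE => e.
  have {}e : z 0 i - z' 0 i = k%:Z * u 0 i.
    by apply/(@intr_inj R); rewrite rmorphB rmorphM.
  have := zk i; have := zk' i; move: e; move: (z 0 i) (z' 0 i) (u 0 i) => a b d e.
  have [d1|d1|d1] := ltrgtP d 0; last by rewrite d1 mulr0 in e; lia.
    have : k%:Z * d <= k%:Z * (-1) by rewrite ler_wpM2l//; lia.
    lia.
  have : k%:Z * 1 <= k%:Z * d by rewrite ler_wpM2l//; lia.
  lia.
- move=> _ [_ /latticeP[z ->] <-].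
  (* Moving [z/k] into [(0,1]^n] moves [z] into [(0,k]^n] by a vector of kM. *)
  have [u uc] := cube_covering (k%:R^-1 *: zvec z : 'rV[R]_n).
  exists (z - k%:Z *: u); last first.
    have -> : zvec (z - k%:Z *: u) = zvec z + k%:R *: zvec (- u) :> 'rV[R]_n.
      by apply/rowP => i; rewrite !mxE rmorphB rmorphM/= rmorphN mulrN.
    by rewrite torus_piD//; exact: lattice_zvec.
  move=> i; rewrite !mxE; have := uc i; rewrite !mxE.
  rewrite -(ltr_pM2l kR) mulr0 -(ler_pM2l kR) mulr1 mulrBr mulVKf ?gt_eqF//.
  by rewrite -(ltr_int R) -(ler_int R) rmorphB rmorphM.
Qed.

Lemma finite_torus_lattice k : (0 < k)%N ->
  finite_set (torus_lattice k : set (torus R n k)).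
Proof.
move=> k0; have [_ _ surj] := grid_torus_bij k0.
by apply: sub_finite_set surj _; exact/finite_image/finite_grid.
Qed.

End Grid.

(** * The measures of the theorem and their limit *)

Section Lattice_measure.
Context {R : realType} {n : nat} (Z : {dot 'rV[R]_n for idfun}).
Variable phi : 'rV[R]_n -> R.
Hypothesis Z_int : forall m m', lattice m -> lattice m' -> Z m m' \is a Num.int.
Hypothesis phi_hull : graph phi = lower_boundary
  (convex_hull [set ((m, quad Z m) : 'rV[R]_n * R^o) | m in lattice]).
Local Notation ZM := (matrix_of_form Z).

Definition dot_det : {nonneg R} := NngNum (ltW (dot_det_gt0 Z)).

Lemma measurable_grid_comp k d (T : measurableType d) (F : 'rV[int]_n -> T) :
  (0 < k)%N -> measurable_fun [set: @borel R n] (F \o grid_ceil k : borel -> T).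
Proof.
by move=> k0 _ A mA; rewrite setTI; exact: (borel_grid_ceil (F @^-1` A) k0).
Qed.

Section Fixed_k.
Variables (k : nat) (k0 : (0 < k)%N).

(* The sum over [B_k(Z)] of the Dirac measures with mass [\det ZM], realized
   as an image of the Lebesgue measure of the unit cube. *)
Definition lattice_measure : {measure set (torus R n k) -> \bar R} :=
  cube_push (dot_det%:num * k%:R ^+ n)%:nng
    (measurable_grid_comp (fun z => torus_pi k (zvec z : 'rV[R]_n)) k0).

(** The total mass [\det ZM * k^n] is spread over boxes of volume [k^-n], one for each point of
    [B_k(Z)]. *)
Lemma lattice_measureE A :
  lattice_measure A = \sum_(p \in torus_lattice k `&` A) (\det ZM)%:E.
Proof.
have kn0 : (k%:R ^+ n : R) != 0 by rewrite expf_neq0// pnatr_eq0 -lt0n.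
rewrite cube_pushE.
rewrite [X in (_ * X)%E](Vol_grid_ceil
  ((fun z => torus_pi k (zvec z : 'rV[R]_n)) @^-1` A) k0).
rewrite ge0_mule_fsumr; last first.
  by move=> z; rewrite lee_fin exprn_ge0.
have [_ inj surj] := @grid_torus_bij R n k k0.
rewrite (@reindex_fsbig _ _ _ _ _ (fun z => torus_pi k (zvec z : 'rV[R]_n))
  (grid k `&` (fun z => torus_pi k (zvec z : 'rV[R]_n)) @^-1` A)).
  apply: eq_fsbigr => z _; rewrite -EFinM /= exprVn.
  by rewrite mulfK.
split.
- by move=> z [zk Az]; split => //; exists (zvec z) => //; exact: lattice_zvec.
- by move=> z z' /set_mem[zk _] /set_mem[zk' _]; apply: inj; exact/mem_set.
- by move=> p [/surj[z zk zp] Ap]; exists z => //; split => //=; rewrite zp.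
Qed.

Lemma locally_given_lattice_measure : locally_given (MA phi) lattice_measure.
Proof.
move=> U oU injU E bE EU; rewrite lattice_measureE.
have bij : set_bij (lattice `&` E)
    (torus_lattice k `&` torus_pi k @` E) (torus_pi k).
  split.
  - by move=> m [mL Em]; split; exists m.
  - by move=> m m' /set_mem[_ Em] /set_mem[_ Em']; apply: injU; exact/mem_set/EU.
  - move=> _ [[m mL <-] [x Ex /torus_piP[m' mL' e]]]; exists x; last first.
      by apply/torus_piP; exists m'.
    (* [x] differs from the lattice point [m] by a vector of kM, so it is a lattice point itself. *)
    split=> //; rewrite -(subrK m x) e scaler_nat.
    by apply: latticeD => // i; rewrite mulmxnE rpredMn.
rewrite (MA_phi Z_int phi_hull); first exact: reindex_fsbig bij.
have : (lattice `&` E #= torus_lattice k `&` torus_pi k @` E)%card.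
  by apply/card_set_bijP; exists (torus_pi k).
move=> /eq_finite_set ->; apply: finite_setIl.
exact: finite_torus_lattice.
Qed.

Lemma lattice_measure_dirac A :
  (lattice_measure A =
    (\det ZM)%:E * \sum_(m \in torus_lattice k) (\d_m A : \bar R))%E.
Proof.
rewrite lattice_measureE fsbig_mkcondr ge0_mule_fsumr; last first.
  by move=> p; rewrite diracE lee_fin.
apply: eq_fsbigr => p _; rewrite diracE.
by case: ifP => _; rewrite ?mule1 ?mule0.
Qed.

End Fixed_k.

Lemma locally_given_MA_quad :
  locally_given (MA (quad Z)) (cube_push dot_det (@measurable_torus_pi R n 1)).
Proof.
rewrite (_ : MA (quad Z) = fun E => (dot_det%:num%:E * Vol E)%E).
  exact: locally_given_cube_push.
by apply/funext => E; rewrite MA_quad.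
Qed.

Lemma locally_given_Vol : locally_given (@Vol R n)
  (cube_push 1%:nng (@measurable_torus_pi R n 1)).
Proof.
rewrite (_ : @Vol R n = fun E => (1%:nng%:num%:E * Vol E)%E).
  exact: locally_given_cube_push.
by apply/funext => E; rewrite mul1e.
Qed.

Lemma MA_torus_quad (A : set (torus R n 1)) : measurable A ->
  MA_torus 1 (quad Z) A = ((\det ZM)%:E * torus_volume A)%E.
Proof.
move=> mA; rewrite /MA_torus (torus_measureE _ locally_given_MA_quad)//.
by rewrite /torus_volume (torus_measureE _ locally_given_Vol)// !cube_pushE mul1e.
Qed.

(** As [quad Z] is homogeneous of degree 2, the difference at [y] is [k^-2] times the periodic
    bounded function [phi - quad Z] at [k y]. *)
Lemma phi_uniform_cvg : exists g : nat -> torus R n 1 -> R,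
  (forall k, (0 < k)%N -> forall y : 'rV[R]_n,
     g k (torus_pi 1 y) = (k%:R ^+ 2)^-1 * phi (k%:R *: y) - quad Z y) /\
  ereal_sup [set `|g k b|%:E | b in setT] @[k --> \oo] --> 0%E.
Proof.
have gE k y : (0 < k)%N -> (k%:R ^+ 2)^-1 * phi (k%:R *: y) - quad Z y =
    (k%:R ^+ 2)^-1 * (phi (k%:R *: y) - quad Z (k%:R *: y)).
  move=> k0; rewrite quadZ mulrBr mulKf// expf_neq0// pnatr_eq0 -lt0n//.
exists (fun k b => (k%:R ^+ 2)^-1 * phi (k%:R *: repr b) - quad Z (repr b)).
split=> [k k0 y|].
  rewrite !gE//; congr (_ * _).
  have /torus_piP[m mL e] : torus_pi 1 (repr (torus_pi 1 y)) = torus_pi 1 y.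
    by rewrite /torus_pi reprK.
  have -> : repr (torus_pi 1 y) = y + m by rewrite -(scale1r m) -e addrC subrK.
  rewrite scalerDr.
  apply: (phi_sub_quad_periodic phi_hull).
  by rewrite scaler_nat => i; rewrite mulmxnE rpredMn.
have [C Cle] := phi_sub_quad_bounded phi_hull.
(* The bound [C / k^2] is weakened to [C / k] to reach the harmonic sequence; the squeeze starts at
   [k = 1]. *)
apply: (@squeeze_cvge _ _ _ _ (cst 0%E) _ (fun k => (C * k%:R^-1)%:E)).
- exists 1%N => // k /= k1; apply/andP; split.
    pose b : torus R n 1 := torus_pi 1 0.
    apply: ereal_sup_ge; eexists; first by exists b.
    by rewrite lee_fin.
  apply: ge_ereal_sup => _ [b _ <-]; rewrite lee_fin gE//.
  have /andP[h0 h1] := Cle (k%:R *: repr b).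
  have kR : 1 <= k%:R :> R by rewrite ler1n.
  have k0 : 0 < k%:R :> R by rewrite ltr0n.
  rewrite ger0_norm ?mulr_ge0 ?invr_ge0 ?exprn_ge0// mulrC.
  apply: ler_pM; rewrite ?invr_ge0 ?exprn_ge0//.
  by rewrite lef_pV2 ?posrE ?exprn_gt0// expr2 ler_peMl// ltW.
- exact: cvg_cst.
- have h : C * k.+1%:R^-1 @[k --> \oo] --> C * 0.
    by apply: cvgMl_tmp; exact: cvg_harmonic.
  rewrite mulr0 in h; rewrite -cvg_shiftS.
  by apply: cvg_EFin; [exact: nearW|exact: h].
Qed.

Lemma measurable_rescaled_ceil k : (0 < k)%N -> measurable_fun [set: @borel R n]
  ((fun z => torus_pi 1 (k%:R^-1 *: zvec z : 'rV[R]_n)) \o grid_ceil k).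
Proof. exact: measurable_grid_comp. Qed.

(** The inverse dilation turns [ceil (k x)] modulo kM into [ceil (k x) / k] modulo M, and [k^-n]
    cancels the mass factor of [lattice_measure]. What remains is an image of a [cube_measure]
    independent of [k]. *)
Lemma rescaled_MA_torusE k (k0 : (0 < k)%N) (A : set (torus R n 1)) :
  measurable A ->
  mscale (k%:R^-1 ^+ n)%:nng (dilation_pullback (MA_torus k phi)) A =
  cube_push dot_det (measurable_rescaled_ceil k0) A.
Proof.
move=> mA; rewrite /mscale/= /dilation_pullback /pushforward.
have mA' : measurable (@dilation_inv R n k @^-1` A).
  by rewrite -[X in measurable X]setTI; exact: measurable_dilation_inv.
rewrite /MA_torus (torus_measureE k0 (locally_given_lattice_measure k0) mA').
change ((k%:R^-1 ^+ n)%:E * ((dot_det%:num * k%:R ^+ n)%:E *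
    Vol ((fun x => torus_pi k (zvec (grid_ceil k x))) @^-1`
      (@dilation_inv R n k @^-1` A) `&` cube)) =
  dot_det%:num%:E * Vol ((fun x =>
    torus_pi 1 (k%:R^-1 *: zvec (grid_ceil k x))) @^-1` A `&` cube))%E.
rewrite muleA -EFinM mulrCA -exprMn mulVf ?pnatr_eq0 -?lt0n// expr1n mulr1.
congr (_ * Vol (_ `&` _))%E.
by apply/seteqP; split=> x /=; rewrite dilation_inv_pi.
Qed.

Lemma continuous_torus_bounded (f : torus R n 1 -> R) :
  continuous (f \o torus_pi 1) -> exists M, forall b, `|f b| <= M.
Proof.
move=> cf; pose K := [set x : 'rV[R]_n | forall i, `[0, 1]%classic (x 0 i)].
have cK : compact K.
  by apply: (@rV_compact R n (fun=> `[0, 1]%classic)) => i; exact: segment_compact.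
have := compact_bounded (continuous_compact (continuous_subspaceT cf) cK).
move=> [M [_ MP]]; exists (M + 1) => b.
have [z zc] := cube_covering (repr b).
have -> : b = torus_pi 1 (repr b - zvec z).
  rewrite -zvecN -[zvec _]scale1r torus_piD; last exact: lattice_zvec.
  by rewrite /torus_pi reprK.
apply: (MP (M + 1)); first by rewrite ltrDl.
exists (repr b - zvec z) => // i; rewrite /= in_itv/=.
by have := zc i; rewrite !mxE => /andP[/ltW -> ->].
Qed.

Lemma rescaled_ceil_cvg (x : 'rV[R]_n) :
  k.+1%:R^-1 *: zvec (grid_ceil k.+1 x) @[k --> \oo] --> x.
Proof.
apply/cvg_ballP => e e0; near=> k; apply/ball_rVP => // i; rewrite !mxE.
have ke : k.+1%:R^-1 < e by near: k; exact: near_infty_natSinv_lt (PosNum e0).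
apply: le_lt_trans ke.
have kR : 0 < k.+1%:R :> R by [].
have -> : x 0 i - k.+1%:R^-1 * (Num.ceil (k.+1%:R * x 0 i))%:~R =
    k.+1%:R^-1 * (k.+1%:R * x 0 i - (Num.ceil (k.+1%:R * x 0 i))%:~R).
  by rewrite mulrBr mulKf// lt0r_neq0.
rewrite normrM gtr0_norm ?invr_gt0// ler_piMr ?invr_ge0// ler_norml.
have := ceil_itv (k.+1%:R * x 0 i); rewrite rmorphB/=.
by lra.
Unshelve. all: by end_near. Qed.

Lemma rescaled_MA_weak_cvg :
  weak_cvg (fun k => mscale (k%:R^-1 ^+ n)%:nng
                       (dilation_pullback (MA_torus k phi)))
    (MA_torus 1 (quad Z)).
Proof.
move=> f /(_ 0%N) /= cf.
have cf' : continuous f by exact/quotient_continuous.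
have mf : measurable_fun [set: torus R n 1] f.
  apply: (measurability _ (RGenOpens.measurableE R)) => _ [_ [a [b ->] <-]].
  rewrite setTI; apply: sub_sigma_algebra.
  by move/continuousP: cf'; apply; exact: interval_open.
have [M fM] := continuous_torus_bounded cf.
rewrite (eq_measure_integral (cube_push dot_det (@measurable_torus_pi R n 1)));
  last by move=> A mA _; exact: (torus_measureE _ locally_given_MA_quad).
(* Shifting the index drops [k = 0], for which the rescaled measure has no description as an image
   of the cube. *)
rewrite (integral_cube_push _ _ mf fM) -cvg_shiftS.
rewrite (_ : [sequence _]_k = fun k => (\int[cube_measure dot_det]_x
    (f (torus_pi 1 (k.+1%:R^-1 *: zvec (grid_ceil k.+1 x))))%:E)%E); last first.
  apply/funext => k /=.
  rewrite (eq_measure_integral (cube_push dot_det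
    (measurable_rescaled_ceil (ltn0Sn k)))); last first.
    by move=> A mA _; exact: rescaled_MA_torusE.
  exact: integral_cube_push mf fM.
apply: (@dominated_cvg _ _ _ _ _ _ _ _ (cst M%:E)) => //.
- move=> k; apply/measurable_EFinP.
  exact: (measurableT_comp mf (measurable_rescaled_ceil (ltn0Sn k))).
- move=> x _; apply: cvg_EFin; first exact: nearW.
  exact: (cvg_comp _ _ (@rescaled_ceil_cvg x) (cf x)).
- apply: measurable_bounded_integrable => //.
    by rewrite cube_measureE setTI Vol_cube mule1 ltry.
  exists `|M|; split=> // N MN x _ /=; exact: ltW.
- by move=> k x _ /=; rewrite lee_fin.
Qed.

End Lattice_measure.

Unset Implicit Arguments.

Theorem theorem2p2 (R : realType) (n : nat)
    (Z : {dot 'rV[R]_n for idfun})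
    (Z_int : forall m m' : 'rV[R]_n,
      lattice m -> lattice m' -> Z m m' \is a Num.int)
    (phi : 'rV[R]_n -> R)
    (phi_hull : graph phi = lower_boundary
      (convex_hull [set ((m, quad Z m) : 'rV[R]_n * R^o) | m in lattice]))
    (phi_slopes : forall (s : set 'rV[R]_n) (u : 'rV[R]_n),
      maximal_linearity_domain phi s -> affine_on phi s u -> lattice u) :
  [/\ (* the measures on B_k and on B exist *)
      [/\ forall k, (0 < k)%N -> locally_given (MA phi) (MA_torus k phi),
          locally_given (MA (quad Z)) (MA_torus 1 (quad Z))
        & locally_given Vol (@torus_volume R n)],
      (* (1) *)
      forall k, (0 < k)%N -> forall E : set (torus R n k), measurable E ->
        (MA_torus k phi E =
           (\det (matrix_of_form Z))%:E *
             \sum_(m \in torus_lattice k) (\d_m E : \bar R))%E,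
      (* (2) *)
      exists g : nat -> torus R n 1 -> R,
        (forall k, (0 < k)%N -> forall y : 'rV[R]_n,
          g k (torus_pi 1 y) = (k%:R ^+ 2)^-1 * phi (k%:R *: y) - quad Z y) /\
        ereal_sup [set `|g k b|%:E | b in setT] @[k --> \oo] --> 0%E
    & (* (3) *)
      weak_cvg
        (fun k => mscale (k%:R^-1 ^+ n)%:nng
                    (dilation_pullback (MA_torus k phi)))
        (MA_torus 1 (quad Z)) /\
      forall E : set (torus R n 1), measurable E ->
        (MA_torus 1 (quad Z) E =
           (\det (matrix_of_form Z))%:E * torus_volume E)%E].
Proof.
split.
- split=> [k k0||].
  + exact: torus_measure_given (locally_given_lattice_measure Z_int phi_hull k0).
  + exact: torus_measure_given (locally_given_MA_quad Z_int).
  + exact: torus_measure_given (@locally_given_Vol R n).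
- move=> k k0 E mE; rewrite -(lattice_measure_dirac Z k0).
  exact: (torus_measureE k0 (locally_given_lattice_measure Z_int phi_hull k0)).
- exact: phi_uniform_cvg phi_hull.
- split; first exact: rescaled_MA_weak_cvg.
  by move=> E; exact: MA_torus_quad.
Qed.
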